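(* Let $n$ be even (and positive), put $\ell=n/2$, and let $H\colon(\mathbb{H}^{2n+1}_{n/2},0)\to(\mathbb{H}^{2(n+k)+1}_{n/2},0)$ be a formal embedding. If $k<n$, then there exists $T\in\operatorname{Aut}(\mathbb{H}^{2(n+k)+1}_{n/2},0)$ such that $T\circ H$ is either the linear embedding $L(z,w)=(z,0,w)\in\mathbb{C}^n\times\mathbb{C}^k\times\mathbb{C}$ or the embedding $$L_-(z,w)=(z_{\ell+1},\ldots,z_n,z_1,\ldots,z_\ell,0,-w)\in\mathbb{C}^n\times\mathbb{C}^k\times\mathbb{C}.$$
   Context: Notation: for $0\le\ell\le m$, $\langle a,b\rangle_\ell:=-\sum_{j=1}^{\ell}a_jb_j+\sum_{j=\ell+1}^m a_jb_j$ for $a,b\in\mathbb{C}^m$, and $\mathbb{H}^{2m+1}_\ell:=\{(z,w)\in\mathbb{C}^m\times\mathbb{C}:\operatorname{Im}w=\langle z,\bar z\rangle_\ell\}$. $\operatorname{Aut}(\mathbb{H}^{2m+1}_\ell,0)$ is the group of germs of local biholomorphisms $(\mathbb{C}^{m+1},0)\to(\mathbb{C}^{m+1},0)$ preserving $\mathbb{H}^{2m+1}_\ell$ (identified with their Taylor series). A formal embedding $(M,0)\to(M',0)$ of real hypersurfaces $M=\{\rho=0\}\subset\mathbb{C}^{n+1}$, $M'=\{\rho'=0\}\subset\mathbb{C}^{N+1}$ is a vector $H$ of $N+1$ formal power series in $Z\in\mathbb{C}^{n+1}$ without constant terms, with injective differential at $0$, such that $\rho'(H(Z),\overline{H(Z)})$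 is a multiple of $\rho(Z,\bar Z)$ in the ring of formal power series in $(Z,\bar Z)$. *)

(* Defs.v *)
From HB Require Import structures.
From mathcomp Require Import all_boot all_order all_algebra.
From mathcomp Require Import mpoly complex boolp classical_sets filter.
From mathcomp Require Import reals topology.

Set Implicit Arguments.
Unset Strict Implicit.
Unset Printing Implicit Defensive.

Import Order.TTheory GRing.Theory Num.Theory.

Local Open Scope classical_set_scope.
Local Open Scope ring_scope.

(** Formal power series in [n] commuting variables.  The ring laws are
    transported from [{mpoly A[n]}] by truncation. *)

Record fps (n : nat) (A : Type) := Fps { fcoef :> 'X_{1..n} -> A }.

HB.instance Definition _ (n : nat) (A : Type) := gen_eqMixin (fps n A).
HB.instance Definition _ (n : nat) (A : Type) := gen_choiceMixin (fps n A).

Lemma fpsP (n : nat) (A : Type) (f g : fps n A) :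
  (forall m, f m = g m) -> f = g.
Proof. by case: f g => [f] [g] /= fg; congr Fps; apply/funext. Qed.

Section Ring.
Variables (n : nat) (A : comNzRingType).
Implicit Types f g h : fps n A.

Definition fzero : fps n A := Fps (fun=> 0).
Definition fopp f : fps n A := Fps (fun m => - f m).
Definition fadd f g : fps n A := Fps (fun m => f m + g m).

Fact faddA : associative fadd.
Proof. by move=> f g h; apply: fpsP => m; exact: addrA. Qed.
Fact faddC : commutative fadd.
Proof. by move=> f g; apply: fpsP => m; exact: addrC. Qed.
Fact fadd0 : left_id fzero fadd.
Proof. by move=> f; apply: fpsP => m; exact: add0r. Qed.
Fact faddN : left_inverse fzero fopp fadd.
Proof. by move=> f; apply: fpsP => m; exact: addNr. Qed.

HB.instance Definition _ :=
  GRing.isZmodule.Build (fps n A) faddA faddC fadd0 faddN.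

Definition fconst (c : A) : fps n A := Fps (fun m => c *+ (m == 0%MM)).
Definition fvar (i : 'I_n) : fps n A := Fps (fun m => (m == U_(i)%MM)%:R).

Definition fmul f g : fps n A := Fps (fun m =>
  \sum_(k : 'X_{1..n < (mdeg m).+1, (mdeg m).+1} | m == (k.1 + k.2)%MM)
    f k.1 * g k.2).

Let trunc (d : nat) f : {mpoly A[n]} :=
  \sum_(m : 'X_{1..n < d}) f m *: 'X_[m].

Let mcoeff_trunc d f m : (mdeg m < d)%N -> (trunc d f)@_m = f m.
Proof. by move=> md; rewrite mcoeff_mpoly. Qed.

Let fmulE f g m d : (mdeg m < d)%N ->
  fmul f g m = (trunc d f * trunc d g)@_m.
Proof.
move=> md; rewrite (mcoeff_poly_mul _ _ (ltnSn (mdeg m))) /=.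
apply: eq_bigr => -[k1 k2] _ /=.
have lt (k : 'X_{1..n < (mdeg m).+1}) : (mdeg k < d)%N.
  by apply: leq_trans md; exact: bmdeg.
by rewrite !mcoeff_trunc.
Qed.

Let trunc_mul (p q r : {mpoly A[n]}) d m : (mdeg m < d)%N ->
    (forall k, (mdeg k < d)%N -> p@_k = q@_k) ->
  (p * r)@_m = (q * r)@_m.
Proof.
move=> md pq; rewrite !(mcoeff_poly_mul _ _ (ltnSn (mdeg m))) /=.
apply: eq_bigr => -[k1 k2] _ /=; rewrite pq //.
by apply: leq_trans md; exact: bmdeg.
Qed.

Fact fmulC : commutative fmul.
Proof.
by move=> f g; apply: fpsP => m; rewrite !(fmulE _ _ (ltnSn _)) mulrC.
Qed.

Fact fmulA : associative fmul.
Proof.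
move=> f g h; apply: fpsP => m; set d := (mdeg m).+1.
have tr p q k : (mdeg k < d)%N ->
    (trunc d (fmul p q))@_k = (trunc d p * trunc d q)@_k.
  by move=> kd; rewrite mcoeff_trunc // (fmulE _ _ kd).
rewrite !(@fmulE _ _ m d) // mulrC (trunc_mul _ _ (tr g h)) //.
by rewrite (trunc_mul _ _ (tr f g)) // mulrC mulrA.
Qed.

Fact fmul1 : left_id (fconst 1) fmul.
Proof.
move=> f; apply: fpsP => m; rewrite (@fmulE _ _ m (mdeg m).+1) //.
rewrite (@trunc_mul _ 1 _ (mdeg m).+1) ?mul1r ?mcoeff_trunc // => k kd.
by rewrite mcoeff_trunc //= mcoeff1.
Qed.

Fact fmulDl : left_distributive fmul fadd.
Proof.
move=> f g h; apply: fpsP => m /=; rewrite -big_split /=.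
by apply: eq_bigr => k _; rewrite mulrDl.
Qed.

Fact fone_neq0 : fconst 1 != 0 :> fps n A.
Proof.
apply/eqP => /(congr1 (fun f : fps n A => f 0%MM)) /= /eqP.
by rewrite eqxx oner_eq0.
Qed.

HB.instance Definition _ := GRing.Zmodule_isComNzRing.Build (fps n A)
  fmulA fmulC fmul1 fmulDl fone_neq0.

End Ring.

Arguments fvar {n A} i.
Arguments fconst {n A} c.

Definition fps_map (n : nat) (A B : Type) (phi : A -> B) (f : fps n A) : fps n B :=
  Fps (fun m => phi (f m)).

(** Substitution [f(h_1, ..., h_p)].  It is meaningful when the [h_i] have no
    constant term: then [h ^ a] has order at least [|a|], so that only the [a]
    with [|a| <= |m|] contribute to the coefficient of index [m]. *)
Definition fcomp (p n : nat) (A : comNzRingType)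
    (f : fps p A) (h : 'rV[fps n A]_p) : fps n A :=
  Fps (fun m => \sum_(a : 'X_{1..p < (mdeg m).+1})
    f a * (\prod_(i < p) h 0 i ^+ (a : 'X_{1..p}) i) m).

Definition fcompv (q p n : nat) (A : comNzRingType)
    (T : 'rV[fps p A]_q) (H : 'rV[fps n A]_p) : 'rV[fps n A]_q :=
  map_mx (fun f => fcomp f H) T.

(** Transposed Jacobian matrix at [0]: vectors are rows, and the differential
    of [H] at [0] is [v |-> v *m fjac H]. *)
Definition fjac (p q : nat) (A : comNzRingType) (H : 'rV[fps p A]_q) :
    'M[A]_(p, q) :=
  \matrix_(i, j) H 0 j U_(i)%MM.

(** [<a, b>_l]; with 0-based indices, the first [l] coordinates are those
    with [j < l]. *)
Definition sform (A : pzRingType) (l m : nat) (a b : 'rV[A]_m) : A :=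
  - (\sum_(j < m | (j < l)%N) a 0 j * b 0 j)
  + \sum_(j < m | (l <= j)%N) a 0 j * b 0 j.

Section Hyperquadric.
Variable R : realType.
Local Notation C := (R[i]).

(** Points of C^(m+1) are rows [row_mx z w] with [z : 'rV_m] and
    [w : 'rV_1]. *)
Definition hyperquadric (l m : nat) : set 'rV[C]_(m + 1) :=
  [set Z | 'Im (rsubmx Z 0 0) =
           sform l (lsubmx Z) (map_mx Num.conj (lsubmx Z))].

(** A real-analytic (or formal) function rho(Z, Zbar) of [Z] in C^p is a
    series in [p + p] variables: the first [p] stand for [Z] and the last [p]
    for [Zbar]. *)
Definition Zvars (p : nat) : 'rV[fps (p + p) C]_p :=
  \row_i fvar (lshift p i).
Definition Zbvars (p : nat) : 'rV[fps (p + p) C]_p :=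
  \row_i fvar (rshift p i).

(** [(w - wbar) / 2i - <z, zbar>_l] *)
Definition hq_rho (l m : nat) : fps ((m + 1) + (m + 1)) C :=
  let Z := Zvars (m + 1) in let Zb := Zbvars (m + 1) in
  fconst ((2 * 'i)^-1) * (rsubmx Z 0 0 - rsubmx Zb 0 0)
  - sform l (lsubmx Z) (lsubmx Zb).

Definition fholo (p q : nat) (H : 'rV[fps p C]_q) : 'rV[fps (p + p) C]_q :=
  fcompv H (Zvars p).
Definition fantiholo (p q : nat) (H : 'rV[fps p C]_q) : 'rV[fps (p + p) C]_q :=
  fcompv (map_mx (fps_map Num.conj) H) (Zbvars p).

Definition formal_embedding (p q : nat)
    (rho : fps (p + p) C) (rho' : fps (q + q) C) (H : 'rV[fps p C]_q) : Prop :=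
  [/\ forall j, H 0 j 0%MM = 0,
      injective (fun v : 'rV[C]_p => v *m fjac H)
    & exists g : fps (p + p) C,
        fcomp rho' (row_mx (fholo H) (fantiholo H)) = g * rho].

Definition fterm (p : nat) (f : fps p C) (Z : 'rV[C]_p) (a : 'X_{1..p}) : C :=
  f a * \prod_(i < p) Z 0 i ^+ a i.

(** [F] is holomorphic near [0] with Taylor series [f]: near [0], the series
    [f] converges absolutely to [F].  The tags [^o] only select the standard
    topology of the complex numbers. *)
Definition taylor0 (p : nat) (F : 'rV[C]_p -> C) (f : fps p C) : Prop :=
  \forall Z \near (0 : 'rV[C^o]_p),
    (exists M : C, forall d : nat,
        \sum_(a : 'X_{1..p < d}) `|fterm f Z a| <= M) /\
    (fun d : nat => \sum_(a : 'X_{1..p < d}) fterm f Z a) @ \oo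
      --> (F Z : C^o).

Definition taylor0v (p q : nat) (F : 'rV[C]_p -> 'rV[C]_q)
    (T : 'rV[fps p C]_q) : Prop :=
  forall j, taylor0 (fun Z => F Z 0 j) (T 0 j).

Definition biholo_germ (p : nat) (F : 'rV[C]_p -> 'rV[C]_p)
    (T : 'rV[fps p C]_p) : Prop :=
  [/\ F 0 = 0, taylor0v F T
    & exists (G : 'rV[C]_p -> 'rV[C]_p) (S : 'rV[fps p C]_p),
        [/\ G 0 = 0, taylor0v G S
          & \forall Z \near (0 : 'rV[C^o]_p), G (F Z) = Z /\ F (G Z) = Z]].

(** Aut(H_l^(2m+1), 0), each germ being identified with its Taylor series. *)
Definition hq_aut (l m : nat) : set 'rV[fps (m + 1) C]_(m + 1) :=
  [set T | exists F : 'rV[C]_(m + 1) -> 'rV[C]_(m + 1),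
     biholo_germ F T /\
     \forall Z \near (0 : 'rV[C^o]_(m + 1)),
       hyperquadric l Z <-> hyperquadric l (F Z)].

Definition zcoord (n : nat) : 'rV[fps (n + 1) C]_n :=
  \row_j fvar (lshift 1 j).
Definition wcoord (n : nat) : 'rV[fps (n + 1) C]_1 :=
  \row_j fvar (rshift n j).

Definition emb_lin (n k : nat) : 'rV[fps (n + 1) C]_(n + k + 1) :=
  row_mx (row_mx (zcoord n) 0) (wcoord n).

(** [rot] sends [z_1, ..., z_n] to [z_(l+1), ..., z_n, z_1, ..., z_l]. *)
Definition emb_minus (l n k : nat) : 'rV[fps (n + 1) C]_(n + k + 1) :=
  let z' := \row_(j < n) (rot l [seq zcoord n 0 i | i <- enum 'I_n])`_j in
  row_mx (row_mx z' 0) (- wcoord n).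

End Hyperquadric.

Arguments hyperquadric R l m _ : clear implicits.
Arguments hq_rho R l m : clear implicits.
Arguments hq_aut R l m _ : clear implicits.
Arguments emb_lin R n k : clear implicits.
Arguments emb_minus R l n k : clear implicits.

(* Main.v *)
Require Import Defs.
From HB Require Import structures.
From mathcomp Require Import all_boot all_order all_algebra.
From mathcomp Require Import mpoly complex boolp classical_sets filter.
From mathcomp Require Import reals topology.
From mathcomp Require Import zify ring.

Set Implicit Arguments.
Unset Strict Implicit.
Unset Printing Implicit Defensive.

Import Order.TTheory GRing.Theory Num.Theory.

Local Open Scope classical_set_scope.
Local Open Scope ring_scope.

(** The target form has no more negative directions than the source form, and
    this makes the map rigid.  Write [H = (f, phi, g)], with [f] and [phi] the
    components in C^n and C^k, and treat [(z, w)] and their conjugates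
    [(chi, tau)] as independent variables.  With [kap = 1 / 2i], the hypothesis
    reads
<<
  kap (g(z,w) - g*(chi,tau)) - <f, f*> - phi . phi* = q (kap (w - tau) - <z, chi>)
>>
    for some power series [q].

    Transversality.  The coefficients of [z_i chi_j] say that [dH(0)] pulls the
    target form back to [c] times the source form, where [c] is the coefficient
    of [w] in [g].  If [c] were zero, an [n]-dimensional space would be
    isotropic for a form with only [n / 2 < n] negative directions
    ([emb_transversal]).  The sign of [c] decides between the two normal forms:
    exchanging the two halves of the [z]-coordinates and reversing [w] changes
    the sign of the source form, so both cases are one computation with signs
    [s] and [eps].

    Normalization.  By a Witt-type theorem ([herm_extend]), [dH(0)] on the
    [z]-space extends to a similitude of the target form.  Composing its
    inverse with a linear fractional automorphism that removes the [w]-linear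
    part of [(f, phi)] and the real part of the [w^2]-coefficient of [g] yields
    the required [T] ([normal_form]).  It is an automorphism germ since
    [1 / (1 - linear form)] is a convergent geometric series
    ([taylor0_linfrac]), and the identity above survives the substitution
    because a linear fractional automorphism acts linearly on homogeneous
    coordinates ([polar_rho_heis]).

    Rigidity ([normalized_rigidity]).  If [sum_j phi_j(z) phi_j*(chi)] is a
    multiple of [<z, chi>], then [phi = 0]: summing the coefficients of
    [z^a chi^a] over [|a| = d] gives [sum |phi_(j,a)|^2] on one side and a
    multiple of the trace [sum eps_t = 0] on the other ([diag_vanish]).  On
    [w = tau = 0] this gives [phi(z, 0) = 0].  On [tau = 0] it follows that
    [kap g(z,w) - <f(z,w), chi>] is affine in [chi] and a multiple of
    [kap w - <z, chi>]; comparing powers of [chi] forces [f = u z] and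
    [g = u w] for one series [u].  Once this is inserted, both sides can be
    divided by [w tau], and the same argument one order higher gives [u = 1],
    and then [phi = 0] by induction on the order in [w]. *)

(** * Multiples of the defining function, coefficient by coefficient *)

Section CoefMul.
Variables (p : nat) (A : nzRingType).
Implicit Types (X : 'X_{1..p} -> A) (a : 'X_{1..p}) (i : 'I_p).

(** The coefficients of ['X_i * X], for a family [X] of coefficients. *)
Definition mulU i X a : A := if (0 < a i)%N then X (a - U_(i))%MM else 0.

Lemma subm1K a i : (0 < a i)%N -> (a - U_(i) + U_(i))%MM = a.
Proof.
move=> ai; apply: submK; apply/mnm_lepP => j; rewrite mnm1E.
by case: eqP => // <-.
Qed.

Lemma mulUD1 i X a : mulU i X (a + U_(i))%MM = X a.
Proof. by rewrite /mulU mnmDE mnm1E eqxx addn1 /= addmK. Qed.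

Lemma mulU_eq0 i X a : a i = 0%N -> mulU i X a = 0.
Proof. by rewrite /mulU => ->. Qed.

Lemma eq_mulU i X Y a : (forall b, X b = Y b) -> mulU i X a = mulU i Y a.
Proof. by rewrite /mulU => ->. Qed.

Lemma mdeg_subm1 a i : (0 < a i)%N -> (mdeg (a - U_(i))%MM).+1 = mdeg a.
Proof. by move=> ai; rewrite -{2}(subm1K ai) mdegD mdeg1 addn1. Qed.

Lemma mdeg_move a i j :
  (0 < (a + U_(i))%MM j)%N -> mdeg (a + U_(i) - U_(j))%MM = mdeg a.
Proof. by move=> /mdeg_subm1; rewrite mdegD mdeg1 addn1 => -[]. Qed.

Lemma mcoeffMU (q : {mpoly A[p]}) i a : (q * 'X_i)@_a = mulU i (fun b => q@_b) a.
Proof.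
rewrite /mulU; case: ifP => [ai|ai]; first by rewrite -{1}(subm1K ai) addmC mcoeffMX.
rewrite mcoeffM big1 // => -[/= b c] /eqP abc; rewrite mcoeffX.
case: eqP => [cU|]; last by rewrite mulr0.
by have := congr1 (fun m : 'X_{1..p} => m i) abc; rewrite mnmDE -cU mnm1E eqxx addn1 => E; rewrite E in ai.
Qed.

Lemma mcoeff_sum_lt d (f : 'X_{1..p} -> A) a :
  (\sum_(m : 'X_{1..p < d}) f m *: 'X_[m])@_a = if (mdeg a < d)%N then f a else 0.
Proof.
case: ifP => ad; first by rewrite mcoeff_mpoly.
rewrite raddf_sum big1 // => m _; rewrite /= mcoeffZ mcoeffX.
case: eqP => [ma|]; last by rewrite mulr0.
by have := bmdeg m; rewrite ma ad.
Qed.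

End CoefMul.

(** The coefficients of the constant series 1. *)
Definition delta0 (A : nzRingType) (p : nat) (a : 'X_{1..p}) : A := (a == 0%MM)%:R.
Arguments delta0 A {p} a.

Section DivideByRho.
Variables (C : numClosedFieldType) (n : nat).
Local Notation p := (n + 1)%N.
Local Notation w := (rshift n (ord0 : 'I_1)).
Local Notation z t := (lshift 1 t).
Implicit Types (a b : 'X_{1..p}) (t : 'I_n).

Variables (kap s : C) (eps : 'I_n -> C).

(** A series in [(z, w, chi, tau)] is handled through its coefficients [h a b],
    where [a] is the exponent of [(z, w)] and [b] that of [(chi, tau)].  This is
    [z_t * chi_t * h]. *)
Definition mulUU t (h : 'X_{1..p} -> 'X_{1..p} -> C) a b :=
  mulU (z t) (fun a' => mulU (z t) (h a') b) a.

(** The coefficients of [h * (kap s (w - tau) - sum_t eps_t z_t chi_t)].  For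
    [s = 1] the second factor is the polarized defining function of the source;
    the sign [s] serves the maps that reverse the sides of the hyperquadric. *)
Definition rhoM (h : 'X_{1..p} -> 'X_{1..p} -> C) a b : C :=
  kap * s * (mulU w (h^~ b) a - mulU w (h a) b) - \sum_t eps t * mulUU t h a b.

Lemma neq_zw t : (z t == w) = false.
Proof. by apply/negP => /eqP /(congr1 val) /= E; have := ltn_ord t; rewrite E addn0 ltnn. Qed.

Lemma rhoMB h1 h2 a b :
  rhoM (fun a b => h1 a b - h2 a b) a b = rhoM h1 a b - rhoM h2 a b.
Proof.
have E i X Y c : mulU i (fun a => X a - Y a : C) c = mulU i X c - mulU i Y c.
  by rewrite /mulU; case: ifP => // _; rewrite subrr.
have S : \sum_t eps t * mulUU t (fun a b => h1 a b - h2 a b) a b =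
    \sum_t eps t * mulUU t h1 a b - \sum_t eps t * mulUU t h2 a b.
  rewrite -sumrB; apply: eq_bigr => t _; rewrite -mulrBr; congr (_ * _).
  by rewrite /mulUU -E; apply: eq_mulU => a'; rewrite E.
by rewrite /rhoM S !E; ring.
Qed.

Hypothesis (eps0 : forall t, eps t != 0).
Variable t0 : 'I_n.

(** [<z, chi>] is not a zero divisor: the coefficient of
    [z_t0 chi_t0 z^a chi^b] in [<z, chi> h] expresses [h a b] through
    coefficients of [h] in which [z] carries fewer factors other than [z_t0]. *)
Lemma mulUU_regular h i j :
    (forall a b, a w = i -> b w = j -> \sum_t eps t * mulUU t h a b = 0) ->
  forall a b, a w = i -> b w = j -> h a b = 0.
Proof.
move=> H a b; have [m] := ubnP (mdeg a - a (z t0))%N.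
elim: m a b => // m IH a b Hm ai bj.
have := H (a + U_(z t0))%MM (b + U_(z t0))%MM.
rewrite !mnmDE !mnm1E !neq_zw !addn0 => /(_ ai bj).
rewrite (bigD1 t0) //= {1}/mulUU !mulUD1 big1 => [|t tt0].
  by rewrite addr0 => /eqP; rewrite mulf_eq0 (negPf (eps0 _)) => /eqP.
rewrite /mulUU /mulU; case: ifP => [at0|_]; last by rewrite mulr0.
case: ifP => [bt0|_]; last by rewrite mulr0.
have nt : (z t0 == z t) = false.
  by apply/negP => /eqP /lshift_inj E; rewrite E eqxx in tt0.
move: at0; rewrite !mnmDE !mnm1E nt addn0 => at0.
have nt' : (z t == z t0) = false by rewrite eq_sym.
rewrite IH ?mulr0 // !(mnmBE, mnmDE, mnm1E, neq_zw, nt, nt', eqxx) ?addn0 ?subn0 //.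
have D : mdeg (a + U_(z t0) - U_(z t))%MM = mdeg a.
  by rewrite mdeg_move // mnmDE mnm1E nt addn0.
rewrite D; have : (a (z t0) < mdeg a)%N.
  rewrite mdegE (bigD1 (z t0)) //= (bigD1 (z t)) /=; last by rewrite nt'.
  by rewrite -addn1 leq_add2l (leq_trans at0) // leq_addr.
by move=> L; lia.
Qed.

(** If [h * rho] is divisible by [w], so is [h]: modulo [w] the factor [rho] is
    [- kap s tau - <z, chi>], and the coefficients of [h] vanish one power of
    [tau] after the other. *)
Lemma rhoM_div h : (forall a b, a w = 0%N -> rhoM h a b = 0) ->
  forall a b, a w = 0%N -> h a b = 0.
Proof.
move=> H a b a0; have [j] := ubnP (b w); elim: j a b a0 => // j IH a b a0 bj.
apply: (@mulUU_regular h 0%N (b w)) => // {}a b' {}a0 b'j.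
have := H a b' a0; rewrite /rhoM mulU_eq0 // sub0r.
rewrite [mulU w (h a) b'](_ : _ = 0) ?oppr0 ?mulr0 ?sub0r => [/eqP|].
  by rewrite oppr_eq0 => /eqP.
rewrite /mulU; case: ifP => // b'0; rewrite IH //.
by rewrite mnmBE mnm1E eqxx b'j; lia.
Qed.

End DivideByRho.

Section BalancedTrace.
Variables (C : numClosedFieldType) (n : nat).
Local Notation p := (n + 1)%N.
Local Notation w := (rshift n (ord0 : 'I_1)).
Local Notation z t := (lshift 1 t).
Implicit Types (a b : 'X_{1..p}) (t : 'I_n).

Variables (kap s : C) (eps : 'I_n -> C).
Hypothesis (eps0 : forall t, eps t != 0).
Variable t0 : 'I_n.

(** Hence a multiple of [rho] which is divisible by [w * tau] is [w * tau] times
    a multiple of [rho]. *)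
Lemma rhoM_shift h :
    (forall a b, a w = 0%N \/ b w = 0%N -> rhoM kap s eps h a b = 0) ->
  forall a b, rhoM kap s eps (fun a b => h (a + U_(w))%MM (b + U_(w))%MM) a b =
              rhoM kap s eps h (a + U_(w))%MM (b + U_(w))%MM.
Proof.
move=> H a b.
have h0 a' b' : a' w = 0%N \/ b' w = 0%N -> h a' b' = 0.
  case=> E; first by apply: (rhoM_div (kap := kap) (s := s) eps0 t0) E => // a1 b1 E1; apply: H; left.
  apply: (rhoM_div (kap := kap) (s := - s) (h := fun a b => h b a) eps0 t0) E.
  move=> a1 b1 E1; rewrite -[RHS](H b1 a1); last by right.
  rewrite /rhoM; congr (_ - _); first by ring.
  by apply: eq_bigr => t _; rewrite /mulUU /mulU; case: ifP; case: ifP.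
rewrite /rhoM !mulUD1; congr (_ * (_ - _) - _).
- rewrite /mulU; case: ifP => [aw|/negbT]; first by rewrite subm1K.
  by rewrite -eqn0Ngt => /eqP aw; rewrite h0 //; left.
- rewrite /mulU; case: ifP => [aw|/negbT]; first by rewrite subm1K.
  by rewrite -eqn0Ngt => /eqP aw; rewrite h0 //; right.
apply: eq_bigr => t _; congr (_ * _).
rewrite /mulUU /mulU !mnmDE !mnm1E !(eq_sym w) !neq_zw !addn0.
case: ifP => // az; case: ifP => // bz; congr h; apply/mnmP => i;
  rewrite !(mnmBE, mnmDE, mnm1E); case: (w =P i) => [<-|_] /=;
  by rewrite ?neq_zw /=; lia.
Qed.

Lemma rhoM_w0 h a b : a w = 0%N -> b w = 0%N ->
  rhoM kap s eps h a b = - \sum_t eps t * mulUU t h a b.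
Proof. by move=> aw bw; rewrite /rhoM !mulU_eq0 // subrr mulr0 sub0r. Qed.

(** Along [tau = 0] and [chi] a multiple of the [t]-th basis vector, only the
    terms [kap s w] and [eps_t z_t chi_t] of [rho] are left. *)
Lemma rhoM_ray h a t m : rhoM kap s eps h a (U_(z t) *+ m.+1)%MM =
  kap * s * mulU w (h^~ (U_(z t) *+ m.+1)%MM) a
  - eps t * mulU (z t) (h^~ (U_(z t) *+ m)%MM) a.
Proof.
have E i : (U_(z t) *+ m.+1)%MM i = ((z t == i) * m.+1)%N.
  by rewrite mulmnE mnm1E.
rewrite /rhoM [mulU w (h a) _]mulU_eq0 ?E ?neq_zw // subr0; congr (_ - _).
rewrite (bigD1 t) //= big1 => [|t' tt'].
  by rewrite addr0; congr (_ * _); apply: eq_mulU => a'; rewrite mulmS addmC mulUD1.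
rewrite /mulUU /mulU; case: ifP; rewrite ?mulr0 // => _; case: ifP; rewrite ?mulr0 //.
by rewrite E; case: eqP => // /lshift_inj E'; rewrite E' eqxx in tt'.
Qed.

Lemma rhoM_const h a :
  rhoM kap s eps h a 0%MM = kap * s * mulU w (h^~ 0%MM) a.
Proof.
rewrite /rhoM [mulU w (h a) _]mulU_eq0 ?mnm0E // subr0 big1 ?subr0 // => t _.
rewrite /mulUU /mulU mnm0E; case: ifP; rewrite ?mulr0 //.
Qed.

(** Let [h_m] be the coefficient of [chi_t^m], at [tau = 0].  The hypothesis says
    [kap s w h_(m+1) = eps_t z_t h_m] for [m >= m0]; as [w] does not divide
    [z_t], every power of [w] divides [h_m]. *)
Lemma rhoM_rec h t m0 :
    (forall a m, (m0 <= m)%N -> rhoM kap s eps h a (U_(z t) *+ m.+1)%MM = 0) ->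
  forall a m, (m0 <= m)%N -> h a (U_(z t) *+ m)%MM = 0.
Proof.
move=> H a m; have [e] := ubnP (a w); elim: e a m => // e IH a m ai m0m.
have := H (a + U_(z t))%MM m m0m; rewrite rhoM_ray mulUD1.
rewrite [mulU w _ _](_ : _ = 0) => [/eqP|].
  by rewrite mulr0 sub0r oppr_eq0 mulf_eq0 (negPf (eps0 _)) => /eqP.
rewrite /mulU; case: ifP => // aw; rewrite IH ?leqW //.
by move: aw; rewrite mnmBE mnmDE !mnm1E neq_zw eqxx; lia.
Qed.

Hypothesis trace0 : \sum_t eps t = 0.

(** The linear functional adding the coefficients of [z^a chi^a] over [|a| = d]
    multiplies by the trace [sum_t eps_t = 0] when applied to a multiple of
    [<z, chi>], and yields a sum of squared moduli on [sum_j phi_j phi_j*].  Only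
    these diagonal coefficients enter, so the hypothesis mentions no others. *)
Lemma diag_vanish (k : nat) (phi : 'I_k -> 'X_{1..p} -> C) (h : 'X_{1..p} -> C) d :
    (forall a, a w = 0%N -> mdeg a = d ->
       \sum_j phi j a * (phi j a)^* = \sum_t eps t * mulU (z t) h a) ->
  forall j a, a w = 0%N -> mdeg a = d -> phi j a = 0.
Proof.
move=> H.
pose c a := \sum_j phi j a * (phi j a)^*.
pose P a e := (a w == 0%N) && (mdeg a == e).
(* the functional is the evaluation at (1, ..., 1) of the diagonal part *)
pose L : {mpoly C[p]} := \sum_(m : 'X_{1..p < d.+1}) (if P m d then c m else 0) *: 'X_[m].
pose K : {mpoly C[p]} := \sum_(m : 'X_{1..p < d}) (if P m d.-1 then h m else 0) *: 'X_[m].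
have LK : L = K * \sum_t eps t *: 'X_(z t).
  apply/mpolyP => a; rewrite [LHS](mcoeff_sum_lt _ (fun m => if P m d then c m else 0)) mulr_sumr raddf_sum /=.
  under eq_bigr do rewrite -scalerAr mcoeffZ mcoeffMU.
  case: (boolP (P a d)) => [/andP[/eqP aw /eqP ad]|Pa].
    rewrite ad ltnSn [c a]H //; apply: eq_bigr => t _; rewrite /mulU.
    case: ifP => // az; have := mdeg_subm1 az; rewrite ad => da.
    rewrite (mcoeff_sum_lt _ (fun m => if P m d.-1 then h m else 0)) /P.
    by rewrite mnmBE mnm1E neq_zw aw -da ltnS leqnn /= !eqxx.
  rewrite if_same big1 // => t _; rewrite /mulU; case: ifP; rewrite ?mulr0 // => az.
  rewrite (mcoeff_sum_lt _ (fun m => if P m d.-1 then h m else 0)).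
  case: ifP => ad; rewrite ?mulr0 //.
  move: Pa; rewrite /P -(mdeg_subm1 az) mnmBE mnm1E neq_zw subn0.
  by case: d ad {H L K} => // d' _; rewrite eqSS => /negPf ->; rewrite mulr0.
have L1 : L.@[fun=> 1] = \sum_(m : 'X_{1..p < d.+1}) if P m d then c m else 0.
  rewrite raddf_sum; apply: eq_bigr => m _; rewrite /= mevalZ mevalX big1 ?mulr1 //.
  by move=> i _; rewrite expr1n.
have c0 a : 0 <= c a by apply: sumr_ge0 => j _; rewrite -normCK exprn_ge0.
have L0 : L.@[fun=> 1] = 0.
  have S0 : (\sum_t eps t *: 'X_(z t) : {mpoly C[p]}).@[fun=> 1] = 0.
    rewrite -[RHS]trace0 raddf_sum; apply: eq_bigr => t _.
    by rewrite /= mevalZ mevalXU mulr1.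
  by rewrite LK rmorphM /= S0 mulr0.
move=> j a aw ad; have La : (mdeg a < d.+1)%N by rewrite ad.
move/eqP: L0; rewrite L1 psumr_eq0 => [/allP/(_ (BMultinom La))|m _]; last by case: ifP.
rewrite mem_index_enum /P /= aw ad !eqxx => /(_ isT).
rewrite psumr_eq0 => [/allP/(_ j)|i _]; last by rewrite -normCK exprn_ge0.
by rewrite mem_index_enum -normCK expf_eq0 normr_eq0 /= => /(_ isT) /eqP.
Qed.

End BalancedTrace.

(** * Rigidity of normalized maps *)

Section Rigid.
Variables (C : numClosedFieldType) (n k : nat).
Local Notation p := (n + 1)%N.
Local Notation w := (rshift n (ord0 : 'I_1)).
Local Notation z t := (lshift 1 t).
Implicit Types (a b : 'X_{1..p}) (t : 'I_n).

Variables (kap s : C) (eps : 'I_n -> C).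
Hypotheses (kap0 : kap != 0) (s0 : s != 0) (eps0 : forall t, eps t != 0).
Hypotheses (n0 : (0 < n)%N) (sR : s^* = s) (trace0 : \sum_t eps t = 0).

Let t0 : 'I_n := Ordinal n0.

Lemma mulUU_diag t (h : 'X_{1..p} -> 'X_{1..p} -> C) a :
  mulUU t h a a = mulU (z t) (fun b => h b b) a.
Proof. by rewrite /mulUU /mulU; case: (0 < _)%N. Qed.

(** By [diag_vanish] at [w = tau = 0] all the [phi_j] are divisible by [w]; then
    divide by [w * tau] and start again. *)
Lemma sqr_vanish (phi : 'I_k -> 'X_{1..p} -> C) h :
    (forall a b, rhoM kap s eps h a b = - \sum_j phi j a * (phi j b)^*) ->
  forall j a, phi j a = 0.
Proof.
move=> H j a; have [e] := ubnP (a w); elim: e phi h H a => // e IH phi h H a ae.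
have phi0 j' b : b w = 0%N -> phi j' b = 0.
  move=> bw; apply: (diag_vanish trace0 (h := fun b => h b b) _ _ bw erefl) => b' b'w _.
  have := H b' b'; rewrite rhoM_w0 // => /oppr_inj <-.
  by apply: eq_bigr => t _; rewrite mulUU_diag.
case aw : (a w) => [|e']; first exact: phi0.
have awp : (0 < a w)%N by rewrite aw.
rewrite -(subm1K awp).
apply: (IH (fun j a => phi j (a + U_(w))%MM)
   (fun a b => h (a + U_(w))%MM (b + U_(w))%MM)); last first.
  by rewrite mnmBE mnm1E eqxx; lia.
move=> a' b'; rewrite (rhoM_shift eps0 t0) ?H //.
by move=> a1 b1 E; rewrite H big1 ?oppr0 // => j' _; case: E => E;
  rewrite (phi0 _ _ E) ?rmorph0 ?mul0r ?mulr0.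
Qed.

Variables (f : 'I_n -> 'X_{1..p} -> C) (phi : 'I_k -> 'X_{1..p} -> C).
Variables (G : 'X_{1..p} -> C) (g : 'X_{1..p} -> 'X_{1..p} -> C).

(** The map with components [f], [phi], [G], normalized to second order, sends
    the source into the target. *)
Hypothesis H_id : forall a b,
  kap * (G a * delta0 C b - delta0 C a * (G b)^*)
    - \sum_t eps t * f t a * (f t b)^* - \sum_j phi j a * (phi j b)^*
  = rhoM kap s eps g a b.
Hypotheses (G00 : G 0%MM = 0) (f00 : forall t, f t 0%MM = 0)
  (phi00 : forall j, phi j 0%MM = 0).
Hypotheses (fz : forall t t', f t U_(z t')%MM = (t == t')%:R)
  (phiz : forall j t, phi j U_(z t)%MM = 0)
  (fw : forall t, f t U_(w)%MM = 0) (phiw : forall j, phi j U_(w)%MM = 0)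
  (Gw : G U_(w)%MM = s)
  (Gww : G (U_(w) + U_(w))%MM + (G (U_(w) + U_(w))%MM)^* = 0).

(* this will turn out to be the factor in [f = u z] and [G = s u w] *)
Let u a := g a 0%MM.

Let delta00 : delta0 C (0%MM : 'X_{1..p}) = 1. Proof. by rewrite /delta0 eqxx. Qed.
Let delta0E a : a != 0%MM -> delta0 C a = 0. Proof. by rewrite /delta0 => /negPf ->. Qed.
Let delta0U i : delta0 C (U_(i)%MM : 'X_{1..p}) = 0.
Proof. by apply: delta0E; rewrite -mdeg_eq0 mdeg1. Qed.
Let conj_delta0 a : (delta0 C a)^* = delta0 C a. Proof. by rewrite /delta0 conjC_nat. Qed.
Let ks0 : kap * s != 0. Proof. by rewrite mulf_neq0. Qed.

(* compare the coefficients of [chi^0 tau^0] *)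
Let G_u a : G a = s * mulU w u a.
Proof.
apply: (mulfI kap0); have := H_id a 0%MM; rewrite rhoM_const mulrA => <-.
rewrite delta00 G00 rmorph0 !big1 ?subr0 ?mulr0 ?mulr1 ?subr0 //.
  by move=> j _; rewrite phi00 rmorph0 mulr0.
by move=> t _; rewrite f00 rmorph0 mulr0.
Qed.

Let G0 a : a w = 0%N -> G a = 0.
Proof. by move=> aw; rewrite G_u mulU_eq0 ?mulr0. Qed.

Let Uz_w t : U_(z t)%MM w = 0%N. Proof. by rewrite mnm1E neq_zw. Qed.

(* compare the coefficients of [chi_t] *)
Let f_g a t : eps t * f t a =
  eps t * mulU (z t) u a - kap * s * mulU w (g^~ U_(z t)%MM) a.
Proof.
have := rhoM_ray kap s eps g a t 0; rewrite mulm0n mulm1n -H_id.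
rewrite delta0U (G0 (Uz_w t)) rmorph0 !mulr0 subr0 mulr0 sub0r.
rewrite [X in _ - X]big1 ?subr0 => [|j _]; last by rewrite phiz rmorph0 mulr0.
rewrite (bigD1 t) //= big1 => [|t' tt']; last by rewrite fz (negPf tt') rmorph0 mulr0.
by rewrite fz eqxx rmorph1 mulr1 addr0 => /eqP; rewrite eqr_oppLR opprB => /eqP.
Qed.

(* compare the coefficients of [tau] *)
Let u_w0 a : a w = 0%N -> u a = delta0 C a.
Proof.
move=> aw; have := H_id a U_(w)%MM; rewrite delta0U mulr0 sub0r Gw sR.
rewrite !big1 ?subr0 => [|t _|j _].
- have E : mulU w (g a) U_(w)%MM = u a.
    by rewrite -[X in mulU _ _ X]add0m mulUD1.
  rewrite /rhoM E (mulU_eq0 _ aw) big1 => [|t _].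
    rewrite sub0r subr0 mulrN mulrN mulrA mulrAC => /oppr_inj /(mulfI ks0) //.
  by rewrite /mulUU /mulU mnm1E eq_sym neq_zw; case: ifP; rewrite ?mulr0.
- by rewrite phiw rmorph0 mulr0.
- by rewrite fw rmorph0 mulr0.
Qed.

Let f_w0 a t : a w = 0%N -> f t a = mulU (z t) (delta0 C) a.
Proof.
move=> aw; apply: (mulfI (eps0 t)); rewrite f_g [mulU w _ a]mulU_eq0 // mulr0 subr0.
congr (_ * _); rewrite /mulU; case: ifP => // az.
by rewrite u_w0 // mnmBE aw.
Qed.

Let phi_w0 j a : a w = 0%N -> phi j a = 0.
Proof.
move=> aw; apply: (diag_vanish trace0 (h := fun b => g b b - delta0 C b) _ _ aw erefl).
move=> b bw _; have := H_id b b; rewrite rhoM_w0 // G0 // mul0r rmorph0 mulr0 subrr.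
rewrite mulr0 sub0r => /eqP; rewrite subr_eq addrC -subr_eq => /eqP <-.
rewrite opprK addrC -sumrB; apply: eq_bigr => t _; rewrite -mulrA -mulrBr.
congr (_ * _); rewrite f_w0 // mulUU_diag /mulU; case: ifP => _.
  by rewrite conj_delta0 -natrM mulnb andbb.
by rewrite rmorph0 mulr0 subr0.
Qed.

Let ray_ne0 t m : (U_(z t) *+ m.+1 != 0)%MM.
Proof. by rewrite -mdeg_eq0 mdegMn mdeg1. Qed.
Let ray_w t m : (U_(z t) *+ m)%MM w = 0%N.
Proof. by rewrite mulmnE mnm1E neq_zw. Qed.

(* on [tau = 0] the identity has degree at most one in [chi] *)
Let g_ray a t : g a U_(z t)%MM = 0.
Proof.
have E : (U_(z t) = U_(z t) *+ 1)%MM by rewrite mulm1n.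
rewrite E; apply: (rhoM_rec (kap := kap) (s := s) eps0 (m0 := 1) _ _ (leqnn _)).
move=> a' m m1; rewrite -H_id (delta0E (ray_ne0 _ _)) (G0 (ray_w _ _)) rmorph0 !mulr0 subrr.
rewrite mulr0 sub0r [X in _ - X]big1 => [|j _]; last first.
  by rewrite (phi_w0 j (ray_w _ _)) rmorph0 mulr0.
rewrite subr0 big1 ?oppr0 // => t' _.
rewrite [f t' (_ *+ _)%MM]f_w0 ?ray_w // /mulU; case: ifP; rewrite ?rmorph0 ?mulr0 // => zt.
rewrite delta0E ?rmorph0 ?mulr0 // -mdeg_eq0 -(eqn_add2r 1).
by have := mdeg_subm1 zt; rewrite mdegMn mdeg1; lia.
Qed.

Let f_u a t : f t a = mulU (z t) u a.
Proof.
apply: (mulfI (eps0 t)); rewrite f_g [mulU w _ a](_ : _ = 0) ?mulr0 ?subr0 //.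
by rewrite /mulU; case: ifP.
Qed.

Let v a := u a - delta0 C a.
Let h a b := g a b - u a * (u b)^*.

(* with [f = u z] and [G = s u w], the multiple [u u*] of [rho] accounts for
   most of the left-hand side *)
Let h_eq a b : rhoM kap s eps h a b =
  kap * s * (v a * (mulU w u b)^* - mulU w u a * (v b)^*) - \sum_j phi j a * (phi j b)^*.
Proof.
rewrite rhoMB -H_id !G_u rmorphM /= sR /v !rmorphB /= conj_delta0 /rhoM.
have E1 i a' b' : mulU i (fun a => u a * (u b')^*) a' = mulU i u a' * (u b')^*.
  by rewrite /mulU; case: ifP; rewrite ?mul0r.
have E2 i a' b' : mulU i (fun b => u a' * (u b)^*) b' = u a' * (mulU i u b')^*.
  by rewrite /mulU; case: ifP; rewrite ?rmorph0 ?mulr0.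
have E3 i a' (c : C) : mulU i (fun a => u a * c) a' = mulU i u a' * c.
  by rewrite /mulU; case: ifP; rewrite ?mul0r.
have -> : \sum_t eps t * f t a * (f t b)^* =
    \sum_t eps t * mulUU t (fun a b => u a * (u b)^*) a b.
  apply: eq_bigr => t _; rewrite -mulrA !f_u; congr (_ * _).
  by rewrite -E3 /mulUU; apply: eq_mulU => a'; rewrite E2.
by rewrite E1 E2; ring.
Qed.

Let h_w0 a b : a w = 0%N \/ b w = 0%N -> rhoM kap s eps h a b = 0.
Proof.
rewrite h_eq; case=> E; rewrite big1 ?subr0.
- by rewrite /v u_w0 // subrr mul0r mulU_eq0 // mul0r subr0 mulr0.
- by move=> j _; rewrite phi_w0 // mul0r.
- by rewrite /v (u_w0 E) subrr rmorph0 mulr0 subr0 mulU_eq0 // rmorph0 !mulr0.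
- by move=> j _; rewrite (phi_w0 _ E) rmorph0 mulr0.
Qed.

Let q a := v (a + U_(w))%MM.
Let psi j a := phi j (a + U_(w))%MM.
Let h1 a b := h (a + U_(w))%MM (b + U_(w))%MM.

Let h1_eq a b : rhoM kap s eps h1 a b =
  kap * s * (q a * (u b)^* - u a * (q b)^*) - \sum_j psi j a * (psi j b)^*.
Proof. by rewrite (rhoM_shift eps0 t0 h_w0) h_eq !mulUD1. Qed.

Let psi_w0 j a : a w = 0%N -> psi j a = 0.
Proof.
move=> aw; have [->|a0] := eqVneq a 0%MM; first by rewrite /psi add0m phiw.
apply: (diag_vanish trace0 (h := fun b => h1 b b) _ _ aw erefl) => b bw bd.
have b0 : delta0 C b = 0 by apply: delta0E; rewrite -mdeg_eq0 bd mdeg_eq0.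
have := h1_eq b b; rewrite u_w0 // b0 rmorph0 mulr0 mul0r subrr mulr0 sub0r.
rewrite rhoM_w0 // => /oppr_inj <-; by apply: eq_bigr => t _; rewrite mulUU_diag.
Qed.

(* the constant term of [q] is real by the identity at the origin, and its real
   part is the normalized coefficient of [w^2] in [G] *)
Let q_w0 a : a w = 0%N -> q a = 0.
Proof.
move=> aw; have q00 : q 0%MM = 0.
  have R : q 0%MM = (q 0%MM)^*.
    have := h1_eq 0%MM 0%MM; rewrite u_w0 ?mnm0E // delta00 rmorph1 mulr1 mul1r.
    rewrite big1 => [|j _]; last by rewrite psi_w0 ?mnm0E // mul0r.
    rewrite rhoM_const mulU_eq0 ?mnm0E // mulr0 subr0 => /esym/eqP.
    by rewrite mulf_eq0 (negPf ks0) subr_eq0 => /eqP.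
  have := Gww; rewrite G_u mulUD1 rmorphM /= sR -mulrDr => /eqP.
  rewrite mulf_eq0 (negPf s0) /=; move: R; rewrite /q /v add0m delta0U subr0 => <-.
  by rewrite -mulr2n mulrn_eq0 /= => /eqP.
have := h1_eq a 0%MM; rewrite q00 rmorph0 mulr0 subr0 rhoM_const mulU_eq0 //.
rewrite u_w0 ?mnm0E // delta00 rmorph1 mulr1 big1 => [|j _]; last by rewrite psi_w0 // mul0r.
by rewrite mulr0 subr0 => /esym/eqP; rewrite mulf_eq0 (negPf ks0) => /eqP.
Qed.

(* on [tau = 0] the identity for [h1] is constant in [chi] *)
Let q_eq0 a : q a = 0.
Proof.
have h10 b : h1 b 0%MM = 0.
  rewrite -(mulm0n U_(z t0)%MM); apply: (rhoM_rec (kap := kap) (s := s) eps0 (m0 := 0)) => // {}b m _.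
  rewrite h1_eq u_w0 ?ray_w // delta0E // (q_w0 (ray_w _ _)) rmorph0 !mulr0 subrr mulr0.
  by rewrite big1 ?subrr // => j _; rewrite (psi_w0 _ (ray_w _ _)) rmorph0 mulr0.
have := h1_eq a 0%MM; rewrite rhoM_const (_ : mulU _ _ _ = 0); last first.
  by rewrite /mulU; case: ifP.
rewrite (u_w0 (mnm0E _)) delta00 rmorph1 mulr1 (q_w0 (mnm0E _)) rmorph0 !mulr0 subr0.
rewrite big1 => [|j _]; last by rewrite (psi_w0 _ (mnm0E _)) rmorph0 mulr0.
by rewrite subr0 => /esym/eqP; rewrite mulf_eq0 (negPf ks0) => /eqP.
Qed.

Let u_eq1 a : u a = delta0 C a.
Proof.
case aw : (a w) => [|e]; first exact: u_w0.
have awp : (0 < a w)%N by rewrite aw.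
by have := q_eq0 (a - U_(w))%MM; rewrite /q /v subm1K // => /eqP; rewrite subr_eq0 => /eqP.
Qed.

(** A normalized map is the linear model [(z, 0, s w)]. *)
Theorem normalized_rigidity :
  [/\ forall t a, f t a = (a == U_(z t))%MM%:R, forall j a, phi j a = 0
    & forall a, G a = s * (a == U_(w))%MM%:R].
Proof.
have E i a : mulU i u a = (a == U_(i))%MM%:R.
  rewrite /mulU u_eq1; case: ifP => ai.
    rewrite /delta0; congr (nat_of_bool _)%:R; apply/eqP/eqP => [E|->].
      by rewrite -(subm1K ai) E add0m.
    by rewrite -{1}[U_(i)%MM]add0m addmK.
  by case: eqP ai => // ->; rewrite mnm1E eqxx.
split=> [t a|j a|a]; rewrite ?f_u ?G_u ?E //.
case aw : (a w) => [|e]; first exact: phi_w0.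
have awp : (0 < a w)%N by rewrite aw.
rewrite -(subm1K awp); apply: (sqr_vanish (phi := psi) (h := h1)) => b b'.
by rewrite h1_eq !q_eq0 rmorph0 mulr0 mul0r subrr mulr0 sub0r.
Qed.

End Rigid.

(** * The ring of formal power series and substitution *)

Section FpsAlgebra.
Variables (n : nat) (A : comNzRingType).
Implicit Types (f g : fps n A) (m : 'X_{1..n}) (q r : {mpoly A[n]}).

Lemma fcoefD f g m : (f + g) m = f m + g m. Proof. by []. Qed.
Lemma fcoefN f m : (- f) m = - f m. Proof. by []. Qed.
Lemma fcoefM f g m : (f * g) m =
  \sum_(k : 'X_{1..n < (mdeg m).+1, (mdeg m).+1} | m == (k.1 + k.2)%MM)
    f k.1 * g k.2.
Proof. by []. Qed.

Lemma fcoef_sum (I : Type) (r : seq I) (P : pred I) (F : I -> fps n A) m :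
  (\sum_(i <- r | P i) F i) m = \sum_(i <- r | P i) (F i) m.
Proof. by elim/big_rec2: _ => // i y x _ <-. Qed.

(** A coefficient of a product depends only on the truncations of the factors;
    with [fpoly] this reduces the computation of products to polynomials. *)
Lemma eq_fcoefM d f f' g g' m : (mdeg m < d)%N ->
    (forall k, (mdeg k < d)%N -> f k = f' k) ->
    (forall k, (mdeg k < d)%N -> g k = g' k) ->
  (f * g) m = (f' * g') m.
Proof.
move=> md ff' gg'; rewrite !fcoefM; apply: eq_bigr => -[k1 k2] _ /=.
have lt (k : 'X_{1..n < (mdeg m).+1}) : (mdeg k < d)%N.
  by apply: leq_trans md; exact: bmdeg.
by rewrite ff' ?gg'.
Qed.

Definition fpoly q : fps n A := Fps (fun m => q@_m).

Fact fpoly_is_zmod_morphism : zmod_morphism fpoly.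
Proof. by move=> q r; apply: fpsP => m /=; rewrite mcoeffB. Qed.
Fact fpoly_is_monoid_morphism : monoid_morphism fpoly.
Proof.
split=> [|q r]; apply: fpsP => m /=; first by rewrite mcoeff1.
by rewrite mcoeffM.
Qed.
HB.instance Definition _ :=
  GRing.isZmodMorphism.Build {mpoly A[n]} (fps n A) fpoly fpoly_is_zmod_morphism.
HB.instance Definition _ :=
  GRing.isMonoidMorphism.Build {mpoly A[n]} (fps n A) fpoly fpoly_is_monoid_morphism.

Lemma fpolyC c : fpoly c%:MP = fconst c.
Proof. by apply: fpsP => m /=; rewrite mcoeffC eq_sym mulr_natr. Qed.

Lemma fpolyX i : fpoly 'X_i = fvar i.
Proof. by apply: fpsP => m /=; rewrite mcoeffX eq_sym. Qed.

Fact fconst_is_zmod_morphism : zmod_morphism (@fconst n A).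
Proof. by move=> c d; rewrite -!fpolyC !rmorphB. Qed.
Fact fconst_is_monoid_morphism : monoid_morphism (@fconst n A).
Proof. by split=> // c d; rewrite -!fpolyC !rmorphM. Qed.
HB.instance Definition _ :=
  GRing.isZmodMorphism.Build A (fps n A) (@fconst n A) fconst_is_zmod_morphism.
HB.instance Definition _ :=
  GRing.isMonoidMorphism.Build A (fps n A) (@fconst n A) fconst_is_monoid_morphism.

Definition ftrunc d f : {mpoly A[n]} := \sum_(m : 'X_{1..n < d}) f m *: 'X_[m].

Lemma mcoeff_ftrunc d f m : (mdeg m < d)%N -> (ftrunc d f)@_m = f m.
Proof. by move=> md; rewrite mcoeff_sum_lt md. Qed.

Lemma fcoefCM c f m : (fconst c * f) m = c * f m.
Proof.
rewrite -fpolyC (eq_fcoefM (f' := fpoly c%:MP) (g' := fpoly (ftrunc (mdeg m).+1 f)) (ltnSn _)) //.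
  by rewrite -rmorphM /= mcoeffCM mcoeff_ftrunc.
by move=> k kd /=; rewrite mcoeff_ftrunc.
Qed.

Lemma fcoefMU f i m : (f * fvar i) m = mulU i f m.
Proof.
rewrite -fpolyX (eq_fcoefM (f' := fpoly (ftrunc (mdeg m).+1 f)) (g' := fpoly 'X_i) (ltnSn _)) //.
  rewrite -rmorphM /= mcoeffMU /mulU; case: ifP => // mi.
  by rewrite mcoeff_ftrunc // (leq_ltn_trans (mdegB _ _)).
by move=> k kd /=; rewrite mcoeff_ftrunc.
Qed.

Definition order_ge d f := forall m, (mdeg m < d)%N -> f m = 0.

Lemma order_geM d e f g : order_ge d f -> order_ge e g -> order_ge (d + e) (f * g).
Proof.
move=> Hf Hg m md; rewrite fcoefM big1 // => -[k1 k2] /= /eqP mk.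
case: (ltnP (mdeg k1) d) => [/Hf->|k1d]; first by rewrite mul0r.
rewrite [g _]Hg ?mulr0 //; have := congr1 (@mdeg n) mk; rewrite mdegD.
by move=> E; rewrite E in md; lia.
Qed.

Lemma order_geX d f e : order_ge d f -> order_ge (d * e) (f ^+ e).
Proof.
move=> Hf; elim: e => [|e IH]; first by rewrite muln0 => m.
by rewrite exprS mulnS; apply: order_geM.
Qed.

Lemma order_ge_prod (I : Type) (r : seq I) (d : I -> nat) (F : I -> fps n A) :
  (forall i, order_ge (d i) (F i)) ->
  order_ge (\sum_(i <- r) d i) (\prod_(i <- r) F i).
Proof.
move=> H; elim: r => [|i r IH]; first by rewrite !big_nil => m.
by rewrite !big_cons; apply: order_geM.
Qed.

Lemma order_ge1 f : f 0%MM = 0 -> order_ge 1 f.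
Proof. by move=> f0 m; rewrite ltnS leqn0 mdeg_eq0 => /eqP ->. Qed.

Lemma fcoefM0 f g : (f * g) 0%MM = f 0%MM * g 0%MM.
Proof.
rewrite (eq_fcoefM (f' := fconst (f 0%MM)) (g' := fconst (g 0%MM)) (d := 1)) ?mdeg0 //.
- by rewrite fcoefCM /= eqxx.
- by move=> k; rewrite ltnS leqn0 mdeg_eq0 => /eqP -> /=; rewrite eqxx.
- by move=> k; rewrite ltnS leqn0 mdeg_eq0 => /eqP -> /=; rewrite eqxx.
Qed.

Lemma fcoefM_UU f g i : f 0%MM = 0 -> g 0%MM = 0 ->
  (f * g) (U_(i) + U_(i))%MM = f U_(i)%MM * g U_(i)%MM.
Proof.
move=> f0 g0; rewrite fcoefM.
have L : (mdeg (U_(i)%MM : 'X_{1..n}) < (mdeg (U_(i) + U_(i))%MM).+1)%N by rewrite mdegD mdeg1.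
rewrite (bigD1 (BMultinom L, BMultinom L)) //= big1 ?addr0 // => -[k1 k2] /andP[/eqP /= E ne].
have [k10|k10] := eqVneq (k1 : 'X_{1..n}) 0%MM; first by rewrite k10 f0 mul0r.
have [k20|k20] := eqVneq (k2 : 'X_{1..n}) 0%MM; first by rewrite k20 g0 mulr0.
have : mdeg k1 = 1%N /\ mdeg k2 = 1%N.
  have E' : (1 + 1 = mdeg k1 + mdeg k2)%N by rewrite -mdegD -E mdegD !mdeg1.
  move: k10 k20; rewrite -!mdeg_eq0; lia.
case=> /eqP/mdeg1P[j1 /eqP E1] /eqP/mdeg1P[j2 /eqP E2].
have Uj j j' : (U_(i) + U_(i) = U_(j) + U_(j'))%MM -> i = j :> 'I_n.
  move=> /(congr1 (fun m : 'X_{1..n} => m j)); rewrite !mnmDE !mnm1E eqxx.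
  by case: eqP => // _; lia.
case/negP: ne; apply/eqP; congr pair; apply: val_inj => /=; move: E; rewrite E1 E2.
  by move/Uj ->.
by rewrite [X in _ = X]addmC => /Uj ->.
Qed.

End FpsAlgebra.

Section Composition.
Variables (p n : nat) (A : comNzRingType) (h : 'rV[fps n A]_p).
Hypothesis h0 : forall i, h 0 i 0%MM = 0.
Implicit Types (f g : fps p A) (q : {mpoly A[p]}).

Let fval q : fps n A := mmap fconst (fun i => h 0 i) q.

(* [h^a] has order at least [|a|] *)
Let fval_order d q : (forall k, (mdeg k < d)%N -> q@_k = 0) -> order_ge d (fval q).
Proof.
move=> H m md; rewrite /fval /mmap fcoef_sum big1 // => a _; rewrite fcoefCM.
case: (ltnP (mdeg a) d) => [/H->|ad]; first by rewrite mul0r.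
have O : order_ge (mdeg a) (mmap1 (fun i => h 0 i) a).
  rewrite mdegE /mmap1; apply: order_ge_prod => i.
  by have := order_geX (e := a i) (order_ge1 (h0 i)); rewrite mul1n.
by rewrite O ?mulr0 // (leq_trans md).
Qed.

(** Any sufficiently long truncation of [f] computes the coefficient, so that
    substitution inherits its algebraic laws from polynomial evaluation. *)
Lemma fcompE d f m : (mdeg m < d)%N ->
  fcomp f h m = mmap fconst (fun i => h 0 i) (ftrunc d f) m.
Proof.
move=> md; have -> : fcomp f h m = fval (ftrunc (mdeg m).+1 f) m.
  rewrite /fval /ftrunc raddf_sum fcoef_sum; apply: eq_bigr => a _.
  by rewrite /= mmapZ mmapX fcoefCM.
apply/eqP; rewrite -subr_eq0 -/(fval _) -fcoefN -fcoefD /fval -rmorphB; apply/eqP.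
apply: (fval_order (d := (mdeg m).+1)) => // k km.
by rewrite mcoeffB !mcoeff_ftrunc ?subrr // (leq_trans km).
Qed.

(** Substitution respects products only for series without constant term; with
    the proof as an argument, it carries a ring morphism structure. *)
Definition fsubst (_ : forall i, h 0 i 0%MM = 0) f : fps n A := fcomp f h.

Fact fsubst_is_zmod_morphism : zmod_morphism (fsubst h0).
Proof.
move=> f g; apply: fpsP => m /=; rewrite -sumrB; apply: eq_bigr => a _.
by rewrite mulrBl.
Qed.
Fact fsubst_is_monoid_morphism : monoid_morphism (fsubst h0).
Proof.
split=> [|f g]; apply: fpsP => m.
  rewrite /fsubst (fcompE _ (ltnSn _)) (_ : ftrunc _ _ = 1) ?rmorph1 //.
  apply/mpolyP => k; rewrite mcoeff_sum_lt mcoeff1 /=; case: ifP => // /negbT.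
  by case: eqP => // ->; rewrite mdeg0.
rewrite /fsubst (fcompE _ (ltnSn _)).
rewrite (eq_fcoefM (f' := fval (ftrunc (mdeg m).+1 f))
  (g' := fval (ftrunc (mdeg m).+1 g)) (ltnSn _)) => [|k|k]; try exact: fcompE.
apply/eqP; rewrite -subr_eq0 /fval -rmorphM -fcoefN -fcoefD -rmorphB; apply/eqP.
apply: (fval_order (d := (mdeg m).+1)) => // k km; rewrite mcoeffB mcoeff_ftrunc //.
apply/eqP; rewrite subr_eq0; apply/eqP; set d := (mdeg m).+1 in km *.
rewrite (eq_fcoefM (f' := fpoly (ftrunc d f)) (g' := fpoly (ftrunc d g)) km) => [|j jd|j jd].
- by rewrite -rmorphM.
- by rewrite /= mcoeff_ftrunc.
- by rewrite /= mcoeff_ftrunc.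
Qed.
HB.instance Definition _ :=
  GRing.isZmodMorphism.Build (fps p A) (fps n A) (fsubst h0) fsubst_is_zmod_morphism.
HB.instance Definition _ :=
  GRing.isMonoidMorphism.Build (fps p A) (fps n A) (fsubst h0) fsubst_is_monoid_morphism.

Lemma fsubstC c : fsubst h0 (fconst c) = fconst c.
Proof.
apply: fpsP => m; rewrite /fsubst (fcompE _ (ltnSn _)).
rewrite (_ : ftrunc _ _ = c%:MP) ?mmapC //.
apply/mpolyP => k; rewrite mcoeff_sum_lt mcoeffC /= eq_sym; case: ifP => [_|/negbT].
  by rewrite mulr_natr.
by case: eqP => [<-|]; rewrite ?mulr0 // mdeg0.
Qed.

Lemma fsubstX i : fsubst h0 (fvar i) = h 0 i.
Proof.
apply: fpsP => m; rewrite /fsubst (fcompE (d := (mdeg m).+2)) //.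
rewrite (_ : ftrunc _ _ = 'X_i) ?mmapX ?mmap1U //.
apply/mpolyP => k; rewrite mcoeff_sum_lt mcoeffX /= eq_sym; case: ifP => // /negbT.
by case: eqP => // <-; rewrite mdeg1.
Qed.

End Composition.

Arguments fsubst {p n A h} h0 f : simpl never.

(** * Polarization *)

Section FpsMap.
Variables (n : nat) (A B : comNzRingType) (phi : {rmorphism A -> B}).

Fact fps_map_is_zmod_morphism : zmod_morphism (@fps_map n A B phi).
Proof. by move=> f g; apply: fpsP => m /=; rewrite rmorphB. Qed.
Fact fps_map_is_monoid_morphism : monoid_morphism (@fps_map n A B phi).
Proof.
split=> [|f g]; apply: fpsP => m /=; first by rewrite rmorphMn /= rmorph1.
by rewrite rmorph_sum; apply: eq_bigr => k _; rewrite rmorphM.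
Qed.
HB.instance Definition _ := GRing.isZmodMorphism.Build (fps n A) (fps n B)
  (@fps_map n A B phi) fps_map_is_zmod_morphism.
HB.instance Definition _ := GRing.isMonoidMorphism.Build (fps n A) (fps n B)
  (@fps_map n A B phi) fps_map_is_monoid_morphism.

Lemma fps_mapC c : fps_map phi (fconst c : fps n A) = fconst (phi c).
Proof. by apply: fpsP => m /=; rewrite rmorphMn. Qed.

End FpsMap.

Section Combine.
Variable p : nat.
Implicit Types (a b : 'X_{1..p}) (m : 'X_{1..p + p}).

(** The exponent of [Z^a * Zbar^b]. *)
Definition mjoin a b : 'X_{1..p + p} :=
  [multinom match split i with inl j => a j | inr j => b j end | i < p + p].
Definition mleft m : 'X_{1..p} := [multinom m (lshift p i) | i < p].
Definition mright m : 'X_{1..p} := [multinom m (rshift p i) | i < p].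

Lemma mjoin_l a b i : mjoin a b (lshift p i) = a i.
Proof. by rewrite mnmE (unsplitK (inl i)). Qed.
Lemma mjoin_r a b i : mjoin a b (rshift p i) = b i.
Proof. by rewrite mnmE (unsplitK (inr i)). Qed.

Lemma mjoinK m : mjoin (mleft m) (mright m) = m.
Proof.
by apply/mnmP => i; rewrite -(splitK i); case: (split i) => j /=;
  rewrite ?mjoin_l ?mjoin_r mnmE.
Qed.

Lemma mjoin_inj a b a' b' : mjoin a b = mjoin a' b' -> a = a' /\ b = b'.
Proof.
by move=> E; split; apply/mnmP => i; [have := mjoin_l a b i|have := mjoin_r a b i];
  rewrite E ?mjoin_l ?mjoin_r.
Qed.

Lemma mjoin_ext m a b :
  (forall i, m (lshift p i) = a i) -> (forall i, m (rshift p i) = b i) -> m = mjoin a b.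
Proof.
move=> Ha Hb; rewrite -[m]mjoinK; congr mjoin; apply/mnmP => i; rewrite mnmE;
  by rewrite ?Ha ?Hb.
Qed.

Lemma mjoinD a b a' b' : (mjoin a b + mjoin a' b')%MM = mjoin (a + a') (b + b').
Proof. by apply: mjoin_ext => i; rewrite !mnmDE ?mjoin_l ?mjoin_r. Qed.

Lemma mjoin0 : mjoin 0 0 = 0%MM.
Proof. by apply/esym/mjoin_ext => i; rewrite !mnm0E. Qed.

Lemma mdeg_mjoin a b : mdeg (mjoin a b) = (mdeg a + mdeg b)%N.
Proof.
rewrite !mdegE big_split_ord /=; congr (_ + _)%N; apply: eq_bigr => i _;
  by rewrite ?mjoin_l ?mjoin_r.
Qed.

Lemma mulU_mjoin_l (A : nzRingType) (X : 'X_{1..p + p} -> A) i a b :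
  mulU (lshift p i) X (mjoin a b) = mulU i (fun a => X (mjoin a b)) a.
Proof.
rewrite /mulU mjoin_l; case: ifP => // _; congr X; apply: mjoin_ext => j.
  by rewrite !mnmBE mjoin_l !mnm1E (inj_eq (@lshift_inj _ _)).
by rewrite mnmBE mjoin_r mnm1E eq_lrshift subn0.
Qed.

Lemma mulU_mjoin_r (A : nzRingType) (X : 'X_{1..p + p} -> A) i a b :
  mulU (rshift p i) X (mjoin a b) = mulU i (fun b => X (mjoin a b)) b.
Proof.
rewrite /mulU mjoin_r; case: ifP => // _; congr X; apply: mjoin_ext => j.
  by rewrite mnmBE mjoin_l mnm1E eq_rlshift subn0.
by rewrite !mnmBE mjoin_r !mnm1E (inj_eq (@rshift_inj _ _)).
Qed.

End Combine.

Section Polarization.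
Variable R : realType.
Local Notation C := (R[i]).
Variable p : nat.
Implicit Types (f g : fps p C) (a b : 'X_{1..p}).

Lemma Zvars0 i : (Zvars R p) 0 i 0%MM = 0.
Proof. by rewrite mxE /= eq_sym -mdeg_eq0 mdeg1. Qed.
Lemma Zbvars0 i : (Zbvars R p) 0 i 0%MM = 0.
Proof. by rewrite mxE /= eq_sym -mdeg_eq0 mdeg1. Qed.

(** The entries of [fholo] and [fantiholo], as ring morphisms. *)
Definition holo : fps p C -> fps (p + p) C := fsubst Zvars0.
Definition anti (f : fps p C) : fps (p + p) C := fsubst Zbvars0 (fps_map Num.conj f).

HB.instance Definition _ := GRing.RMorphism.on holo.
HB.instance Definition _ := GRing.RMorphism.copy anti (fsubst Zbvars0 \o @fps_map p C C Num.conj).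

Arguments holo : simpl never.
Arguments anti : simpl never.

Lemma holoC c : holo (fconst c) = fconst c. Proof. exact: fsubstC. Qed.
Lemma antiC c : anti (fconst c) = fconst (c^*).
Proof. by rewrite /anti fps_mapC fsubstC. Qed.

Lemma fcoef_holo f a b : (holo f) (mjoin a b) = if b == 0%MM then f a else 0.
Proof.
have E (c : 'X_{1..p}) : \prod_(i < p) Zvars R p 0 i ^+ c i = fpoly 'X_[mjoin c 0].
  rewrite mpolyXE_id rmorph_prod big_split_ord /= [X in _ = _ * X]big1 ?mulr1.
    by apply: eq_bigr => i _; rewrite mxE rmorphXn mjoin_l /= fpolyX.
  by move=> i _; rewrite mjoin_r mnm0E expr0 rmorph1.
rewrite /holo /fsubst /=.
under eq_bigr => c _ do rewrite E /= mcoeffX.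
case: eqP => [->|b0].
  have L : (mdeg a < (mdeg (mjoin a 0)).+1)%N by rewrite mdeg_mjoin mdeg0 addn0.
  rewrite (bigD1 (BMultinom L)) //= eqxx mulr1 big1 ?addr0 // => c ca.
  case: eqP => [/mjoin_inj[E' _]|]; last by rewrite mulr0.
  by case/negP: ca; apply/eqP/val_inj.
rewrite big1 // => c _; case: eqP => [/mjoin_inj[_ E']|]; last by rewrite mulr0.
by case: b0.
Qed.

Lemma fcoef_anti f a b : (anti f) (mjoin a b) = if a == 0%MM then (f b)^* else 0.
Proof.
have E (c : 'X_{1..p}) : \prod_(i < p) Zbvars R p 0 i ^+ c i = fpoly 'X_[mjoin 0 c].
  rewrite mpolyXE_id rmorph_prod big_split_ord /= [X in _ = X * _]big1 ?mul1r.
    by apply: eq_bigr => i _; rewrite mxE rmorphXn mjoin_r /= fpolyX.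
  by move=> i _; rewrite mjoin_l mnm0E expr0 rmorph1.
rewrite /anti /fsubst /=.
under eq_bigr => c _ do rewrite E /= mcoeffX.
case: eqP => [->|b0].
  have L : (mdeg b < (mdeg (mjoin 0 b)).+1)%N by rewrite mdeg_mjoin mdeg0 add0n.
  rewrite (bigD1 (BMultinom L)) //= eqxx mulr1 big1 ?addr0 // => c ca.
  case: eqP => [/mjoin_inj[_ E']|]; last by rewrite mulr0.
  by case/negP: ca; apply/eqP/val_inj.
rewrite big1 // => c _; case: eqP => [/mjoin_inj[E' _]|]; last by rewrite mulr0.
by case: b0.
Qed.

(** A monomial factors in exactly one way as one in [Z] times one in [Zbar]. *)
Lemma fcoef_sepM (X Y : fps (p + p) C) (u v : 'X_{1..p} -> C) a b :
    (forall a b, X (mjoin a b) = if b == 0%MM then u a else 0) ->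
    (forall a b, Y (mjoin a b) = if a == 0%MM then v b else 0) ->
  (X * Y) (mjoin a b) = u a * v b.
Proof.
move=> HX HY; rewrite fcoefM.
have La : (mdeg (mjoin a 0) < (mdeg (mjoin a b)).+1)%N by rewrite !mdeg_mjoin mdeg0; lia.
have Lb : (mdeg (mjoin 0 b) < (mdeg (mjoin a b)).+1)%N by rewrite !mdeg_mjoin mdeg0; lia.
rewrite (bigD1 (BMultinom La, BMultinom Lb)) /= ?mjoinD ?addm0 ?add0m //.
rewrite HX HY !eqxx big1 ?addr0 // => -[k1 k2] /= /andP[/eqP E ne].
have [k10|k10] := eqVneq (mright k1) 0%MM; last first.
  by rewrite -[X in fcoef _ X * _]mjoinK HX (negPf k10) mul0r.
have [k20|k20] := eqVneq (mleft k2) 0%MM; last first.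
  by rewrite -[X in _ * fcoef _ X]mjoinK HY (negPf k20) mulr0.
have E1 := mjoinK k1; have E2 := mjoinK k2; rewrite k10 in E1; rewrite k20 in E2.
have [Ea Eb] : mleft k1 = a /\ mright k2 = b.
  apply: mjoin_inj; apply/esym; rewrite [LHS]E.
  by rewrite -[X in (X + _)%MM]E1 -[X in (_ + X)%MM]E2 mjoinD addm0 add0m.
case/negP: ne; apply/eqP; congr pair; apply: val_inj; rewrite /=.
  by rewrite -[LHS]E1 Ea.
by rewrite -[LHS]E2 Eb.
Qed.

Lemma fcoef_tensor f g a b : (holo f * anti g) (mjoin a b) = f a * (g b)^*.
Proof. by apply: (fcoef_sepM _ _ (v := fun b => (g b)^*)) => a' b'; rewrite ?fcoef_holo ?fcoef_anti. Qed.

End Polarization.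

Definition signl (S : pzRingType) (l m : nat) (j : 'I_m) : S :=
  if (j < l)%N then -1 else 1.

Lemma sformE (S : pzRingType) (l m : nat) (a b : 'rV[S]_m) :
  sform l a b = \sum_j signl S l j * (a 0 j * b 0 j).
Proof.
rewrite (bigID (fun j : 'I_m => (j < l)%N)) /= /sform; congr (_ + _).
  by rewrite -sumrN; apply: eq_bigr => j jl; rewrite /signl jl mulN1r.
apply: eq_big => j; first by rewrite -leqNgt.
by rewrite leqNgt /signl => /negPf ->; rewrite mul1r.
Qed.

Lemma rmorph_signl (S T : pzRingType) (phi : {rmorphism S -> T}) l m (j : 'I_m) :
  phi (signl S l j) = signl T l j.
Proof. by rewrite /signl; case: ifP; rewrite ?rmorphN rmorph1. Qed.

(** The defining function at two independent points.  It is used over the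
    complex numbers, for points of the hyperquadric, and over power series, for
    maps; [kap] stands for [1 / 2i]. *)
Definition polar_rho (S : pzRingType) (kap : S) (l m : nat) (X Y : 'rV[S]_(m + 1)) : S :=
  kap * (rsubmx X 0 0 - rsubmx Y 0 0) - sform l (lsubmx X) (lsubmx Y).

Lemma rmorph_polar_rho (S T : pzRingType) (phi : {rmorphism S -> T}) kap l m
    (X Y : 'rV[S]_(m + 1)) :
  phi (polar_rho kap l X Y) = polar_rho (phi kap) l (map_mx phi X) (map_mx phi Y).
Proof.
rewrite /polar_rho !sformE rmorphB rmorphM rmorphB rmorph_sum !mxE; congr (_ - _).
by apply: eq_bigr => j _; rewrite !rmorphM rmorph_signl !mxE.
Qed.

Section Bridge.
Variable R : realType.
Local Notation C := (R[i]).
Variables (l m : nat).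

Definition kapC : C := (2 * 'i)^-1.

Lemma kapC_neq0 : kapC != 0.
Proof. by rewrite invr_eq0 mulf_neq0 ?neq0Ci ?pnatr_eq0. Qed.

Lemma kapC2i : kapC * (2 * 'i) = 1.
Proof. by rewrite mulVf // mulf_neq0 ?neq0Ci ?pnatr_eq0. Qed.

(** [hq_rho] is itself the value of [polar_rho] at the variables, and
    substitution is a ring morphism. *)
Lemma fcomp_hq_rho (p : nat) (H : 'rV[fps p C]_(m + 1)) :
    (forall j, H 0 j 0%MM = 0) ->
  fcomp (hq_rho R l m) (row_mx (fholo H) (fantiholo H)) =
  polar_rho (fconst kapC) l (map_mx (@holo R p) H) (map_mx (@anti R p) H).
Proof.
move=> H0; set X := row_mx _ _.
have X0 i : X 0 i 0%MM = 0.
  rewrite mxE -(splitK i); case: (split i) => j; rewrite unsplitK !mxE -mjoin0.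
    by rewrite [LHS]fcoef_holo eqxx.
  by rewrite [LHS]fcoef_anti eqxx H0 rmorph0.
rewrite -[LHS]/(fsubst X0 (polar_rho (fconst kapC) l (Zvars R (m + 1)) (Zbvars R (m + 1)))).
rewrite rmorph_polar_rho /= (fsubstC X0); congr polar_rho; apply/rowP => j.
  by rewrite !mxE (fsubstX X0) /X row_mxEl mxE.
by rewrite !mxE (fsubstX X0) /X row_mxEr !mxE.
Qed.

Lemma fcoef_polar_rho (n : nat) (H : 'rV[fps (n + 1) C]_(m + 1)) a b :
  polar_rho (fconst kapC) l (map_mx (@holo R (n + 1)) H) (map_mx (@anti R (n + 1)) H) (mjoin a b) =
  kapC * (H 0 (rshift m ord0) a * delta0 C b - delta0 C a * (H 0 (rshift m ord0) b)^*)
  - \sum_j signl C l j * (H 0 (lshift 1 j) a * (H 0 (lshift 1 j) b)^*).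
Proof.
rewrite /polar_rho sformE fcoefD fcoefN fcoefCM !mxE; congr (_ * _ - _).
  rewrite fcoefD fcoefN fcoef_holo fcoef_anti /delta0.
  by congr (_ - _); case: ifP; rewrite ?mulr1 ?mulr0 ?mul1r ?mul0r.
rewrite fcoef_sum; apply: eq_bigr => j _.
by rewrite -(rmorph_signl (@fconst _ _)) fcoefCM !mxE fcoef_tensor.
Qed.

Lemma fcoefM_hq_rho (g : fps ((m + 1) + (m + 1)) C) a b :
  (g * hq_rho R l m) (mjoin a b) =
  rhoM kapC 1 (@signl C l m) (fun a b => g (mjoin a b)) a b.
Proof.
rewrite -[hq_rho R l m]/(polar_rho (fconst kapC) l (Zvars R (m + 1)) (Zbvars R (m + 1))).
rewrite /polar_rho sformE (mulrBr g) (mulrCA g) mulr_sumr (mulrBr g) fcoefD fcoefN fcoefCM.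
rewrite fcoefD fcoefN !mxE !fcoefMU mulU_mjoin_l mulU_mjoin_r /rhoM mulr1; congr (_ - _).
rewrite fcoef_sum; apply: eq_bigr => j _.
rewrite -(rmorph_signl (@fconst _ _)) mulrCA fcoefCM !mxE mulrA fcoefMU mulU_mjoin_r.
congr (_ * _); rewrite /mulUU /mulU; case: ifP => [bj|bj].
  by rewrite fcoefMU mulU_mjoin_l.
by case: ifP.
Qed.

End Bridge.

(** * Extension of partial isometries *)

Definition Jmx (S : pzRingType) (l m : nat) : 'M[S]_m := diag_mx (\row_j signl S l j).

Lemma sform_mx (S : comPzRingType) (l m : nat) (a b : 'rV[S]_m) :
  sform l a b = (a *m Jmx S l m *m b^T) 0 0.
Proof.
rewrite sformE mul_mx_diag mxE; apply: eq_bigr => j _.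
by rewrite !mxE mulrA [signl _ _ _ * _]mulrC.
Qed.

Lemma JmxK (S : comPzRingType) (l m : nat) : Jmx S l m *m Jmx S l m = 1%:M.
Proof.
rewrite mul_mx_diag; apply/matrixP => i j; rewrite !mxE /signl.
by case: eqP => [->|]; case: ifP; rewrite ?mulNr ?mulr1n ?mulr0n ?mul1r ?mul0r ?opprK.
Qed.

Section Witt.
Variables (C : numClosedFieldType) (l N : nat).
Implicit Types (u v : 'rV[C]_N).

Definition herm u v : C := sform l u (map_mx Num.conj v).

Lemma hermE u v : herm u v = \sum_j signl C l j * (u 0 j * (v 0 j)^*).
Proof. by rewrite /herm sformE; apply: eq_bigr => j _; rewrite mxE. Qed.

Lemma herm_conj u v : (herm u v)^* = herm v u.
Proof.
rewrite !hermE rmorph_sum; apply: eq_bigr => j _.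
by rewrite !rmorphM /= conjCK rmorph_signl [_^* * _]mulrC.
Qed.

Lemma hermDl u1 u2 v : herm (u1 + u2) v = herm u1 v + herm u2 v.
Proof.
by rewrite !hermE -big_split; apply: eq_bigr => j _; rewrite mxE /=; ring.
Qed.

Lemma hermZl a u v : herm (a *: u) v = a * herm u v.
Proof.
by rewrite !hermE mulr_sumr; apply: eq_bigr => j _; rewrite mxE; ring.
Qed.

Lemma herm0l v : herm 0 v = 0.
Proof. by rewrite -(scale0r 0) hermZl mul0r. Qed.

Lemma herm_suml (I : Type) (r : seq I) (F : I -> 'rV[C]_N) v :
  herm (\sum_(i <- r) F i) v = \sum_(i <- r) herm (F i) v.
Proof.
elim: r => [|i r IH]; first by rewrite !big_nil herm0l.
by rewrite !big_cons hermDl IH.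
Qed.

Lemma hermDr u v1 v2 : herm u (v1 + v2) = herm u v1 + herm u v2.
Proof. by rewrite -herm_conj hermDl rmorphD /= !herm_conj. Qed.
Lemma hermZr a u v : herm u (a *: v) = a^* * herm u v.
Proof. by rewrite -herm_conj hermZl rmorphM /= herm_conj. Qed.
Lemma herm_sumr (I : Type) (r : seq I) (F : I -> 'rV[C]_N) u :
  herm u (\sum_(i <- r) F i) = \sum_(i <- r) herm u (F i).
Proof.
rewrite -herm_conj herm_suml rmorph_sum; apply: eq_bigr => i _; exact: herm_conj.
Qed.

Lemma left_kernel (m m' : nat) (A : 'M[C]_(m, m')) : (m' < m)%N ->
  exists2 v : 'rV[C]_m, v != 0 & v *m A = 0.
Proof.
move=> lt; have : kermx A != 0.
  by rewrite -mxrank_eq0 mxrank_ker subn_eq0 -ltnNge (leq_ltn_trans (rank_leq_col A)).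
by case/rowV0Pn => v /sub_kermxP vA v0; exists v.
Qed.

Lemma herm_pos_coord v : (forall j : 'I_N, (j < l)%N -> v 0 j = 0) ->
  herm v v = \sum_j `|v 0 j| ^+ 2.
Proof.
move=> H; rewrite hermE; apply: eq_bigr => j _; rewrite /signl.
by case: ifP => [/H->|_]; rewrite ?normr0 ?mul0r ?mulr0 ?expr0n // normCK mul1r.
Qed.

Lemma sum_sqr_eq0 (m : nat) (x : 'I_m -> C) :
  \sum_j `|x j| ^+ 2 = 0 -> forall j, x j = 0.
Proof.
move=> /eqP; rewrite psumr_eq0 => [/allP H j|j _]; last by rewrite exprn_ge0.
by have := H j (mem_index_enum j); rewrite expf_eq0 normr_eq0 => /eqP.
Qed.

(** A form with [l] negative directions is positive on the orthogonal complement
    of an [l]-dimensional negative subspace: otherwise [v] and this subspace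
    would span [l + 1] dimensions on which the form is [<= 0], and these meet the
    space where the first [l] coordinates vanish. *)
Lemma herm_orth_gt0 (c : C) (V : nat -> 'rV[C]_N) v : (l <= N)%N -> 0 < c ->
    (forall i j, (i < l)%N -> (j < l)%N -> herm (V i) (V j) = - c *+ (i == j)) ->
    (forall i, (i < l)%N -> herm (V i) v = 0) ->
  v != 0 -> 0 < herm v v.
Proof.
move=> lN c0 VV Vv v0.
have vR : herm v v \is Num.real by apply/CrealP; rewrite herm_conj.
have [//|hle] := real_ltP (rpred0 _) vR.
pose A : 'M[C]_(1 + l, l) := col_mx (\row_j v 0 (widen_ord lN j))
  (\matrix_(i, j) V i 0 (widen_ord lN j)).
have [x x0 xA] := left_kernel A (ltnSn l).
pose a := lsubmx x 0 0; pose b i := rsubmx x 0 i.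
(* a vector of the span with vanishing negative coordinates *)
pose y := a *: v + \sum_(i < l) b i *: V i.
have y0 (j : 'I_N) : (j < l)%N -> y 0 j = 0.
  move=> jl; have := congr1 (fun M : 'rV_l => M 0 (Ordinal jl)) xA.
  rewrite -[x]hsubmxK mul_row_col !mxE big_ord1 !mxE => xE; rewrite -[RHS]xE summxE.
  have -> : widen_ord lN (Ordinal jl) = j by apply: val_inj.
  congr (_ + _); first by rewrite /a mxE.
  apply: eq_bigr => i _; rewrite !mxE.
  by congr (_ * V i 0 _); [rewrite /b mxE | apply: val_inj].
have yy : herm y y = `|a| ^+ 2 * herm v v - c * \sum_(i < l) `|b i| ^+ 2.
  have vV (i : 'I_l) : herm v (V i) = 0 by rewrite -herm_conj Vv ?rmorph0.
  have vS : herm v (\sum_(i < l) b i *: V i) = 0.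
    by rewrite herm_sumr big1 // => i _; rewrite hermZr vV mulr0.
  rewrite /y hermDl hermZl [X in _ * X + _ = _]hermDr hermZr vS addr0 mulrA -normCK.
  congr (_ + _); rewrite herm_suml mulr_sumr -sumrN; apply: eq_bigr => i _.
  rewrite hermZl hermDr hermZr Vv // mulr0 add0r herm_sumr (bigD1 i) //= big1.
    by rewrite hermZr VV // eqxx mulr1n addr0 normCK; ring.
  by move=> j ji; rewrite hermZr VV // eq_sym (inj_eq val_inj) (negPf ji) mulr0.
have bs : 0 <= \sum_(i < l) `|b i| ^+ 2 by apply: sumr_ge0 => i _; rewrite exprn_ge0.
have ys : 0 <= \sum_j `|y 0 j| ^+ 2 by apply: sumr_ge0 => i _; rewrite exprn_ge0.
have av : `|a| ^+ 2 * herm v v <= 0 by rewrite mulr_ge0_le0 // exprn_ge0.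
have cb : 0 <= c * \sum_(i < l) `|b i| ^+ 2 by rewrite mulr_ge0 // ltW.
have E := yy; rewrite (herm_pos_coord y0) in E.
have b0 i : b i = 0.
  apply: sum_sqr_eq0 i; apply/eqP; rewrite -(mulrI_eq0 _ (lregP (lt0r_neq0 c0))).
  rewrite eq_le cb andbT -oppr_ge0 -[X in _ <= X]add0r.
  by rewrite (le_trans ys) // E lerD2r.
have yE : y = a *: v by rewrite /y big1 ?addr0 // => i _; rewrite b0 scale0r.
have y00 : y = 0.
  apply/rowP => j; rewrite [RHS]mxE; apply: sum_sqr_eq0 j; apply/eqP; rewrite eq_le ys andbT.
  by rewrite E -[X in _ <= X]addr0 lerD // oppr_le0.
case/eqP: x0; rewrite -[x]hsubmxK; apply/rowP => j; rewrite [RHS]mxE -(splitK j).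
case: (split j) => j' /=; rewrite ?row_mxEl ?row_mxEr; last by rewrite -[LHS]/(b j') b0.
rewrite [j']ord1 -[LHS]/a; have := y00; rewrite yE => /eqP.
by rewrite scaler_eq0 (negPf v0) orbF => /eqP.
Qed.

(** Witt extension: rows which are orthogonal of prescribed norms are completed
    one at a time, by a vector orthogonal to the previous ones; the first [l]
    rows already span a maximal negative subspace, so the norm of the new vector
    is positive and can be scaled to [c]. *)
Lemma herm_extend (n : nat) (c : C) (P : 'M[C]_(n, N)) :
    (l <= n)%N -> (n <= N)%N -> 0 < c ->
    (forall i j, herm (row i P) (row j P) = (c * signl C l i) *+ (i == j)) ->
  exists2 W : 'M[C]_N, W *m Jmx C l N *m (map_mx Num.conj W)^T = c *: Jmx C l N
    & forall (i : 'I_n) (i' : 'I_N), i = i' :> nat -> row i' W = row i P.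
Proof.
move=> ln nN c0 HP.
pose ok m (V : nat -> 'rV[C]_N) :=
  (forall i j, (i < m)%N -> (j < m)%N ->
     herm (V i) (V j) = (if (i < l)%N then - c else c) *+ (i == j))
  /\ (forall i : 'I_n, V i = row i P).
have step m : (n <= m)%N -> (m <= N)%N -> exists V, ok m V.
  elim: m => [|m IH] nm mN.
    exists (fun=> 0); split=> // i; by have := ltn_ord i; move: nm; lia.
  have [E|nm'] := eqVneq n m.+1.
    exists (fun i => if insub i is Some i' then row i' P else 0); split.
      move=> i j; rewrite -E => i_n j_n; rewrite !insubT HP -val_eqE /=.
      by congr (_ *+ _); rewrite /signl /=; case: ifP; rewrite ?mulrN mulr1.
    by move=> i; rewrite valK.
  have [|V [VV VP]] := IH _ (ltnW mN); first by move: nm nm'; lia.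
  have lm : (l <= m)%N by move: nm nm'; lia.
  pose A : 'M[C]_(N, m) := \matrix_(i, j) (signl C l i * (V j 0 i)^*).
  have [v v0 vA] := left_kernel A mN.
  have vV j : (j < m)%N -> herm v (V j) = 0.
    move=> jm; have := congr1 (fun M : 'rV_m => M 0 (Ordinal jm)) vA.
    rewrite !mxE hermE => E; rewrite -[RHS]E; apply: eq_bigr => i _; rewrite !mxE /=; ring.
  have Vv j : (j < m)%N -> herm (V j) v = 0 by move=> /vV E; rewrite -herm_conj E rmorph0.
  have hv : 0 < herm v v.
    apply: (@herm_orth_gt0 c V) => // [|i j il jl|i il]; first exact: leq_trans ln nN.
      by rewrite VV ?il // (leq_trans _ lm).
    by rewrite Vv // (leq_trans il).
  pose t := sqrtC (c / herm v v).
  have t0 : 0 <= t by rewrite sqrtC_ge0 divr_ge0 // ltW.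
  exists (fun i => if i == m then t *: v else V i); split.
    move=> i j im jm.
    have [Ei|ni] := eqVneq i m; have [Ej|nj] := eqVneq j m.
    - rewrite Ei Ej eqxx mulr1n hermZl hermZr (CrealP (ger0_real t0)) mulrA -expr2 sqrtCK.
      by rewrite ltnNge lm /= divfK // lt0r_neq0.
    - by rewrite hermZl vV ?mulr0 ?Ei 1?eq_sym ?(negPf nj) //; lia.
    - by rewrite hermZr Vv ?mulr0 ?Ej ?(negPf ni) //; lia.
    by rewrite VV //; lia.
  move=> i; rewrite VP; case: eqP => // im; have := ltn_ord i; move: nm nm'; lia.
have [V [VV VP]] := step N nN (leqnn N).
exists (\matrix_(i < N) V i) => [|i i' ii']; last by rewrite rowK -ii' VP.
apply/matrixP => i j.
have -> : (\matrix_(i0 < N) V i0 *m Jmx C l N *m (map_mx Num.conj (\matrix_(i0 < N) V i0))^T) i j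
   = herm (V i) (V j).
  rewrite hermE mul_mx_diag mxE; apply: eq_bigr => k _; rewrite !mxE; ring.
rewrite VV // !mxE /signl val_eqE; case: ifP => _; case: eqP => // _;
  by rewrite ?mulr1n ?mulr0n ?mulr0 ?mulrN ?mulr1.
Qed.

End Witt.

(** * Power series of linear fractional maps *)

Section LinearForms.
Variables (p : nat) (A : comNzRingType).
Implicit Types (v : 'I_p -> A) (q : {mpoly A[p]}) (a : 'X_{1..p}).

Definition linp v : {mpoly A[p]} := \sum_i v i *: 'X_i.

Lemma linp_homog v : linp v \is 1.-homog for mdeg.
Proof. by apply: rpred_sum => i _; apply: rpredZ; rewrite dhomogX /= mdeg1. Qed.

Lemma homog_linpX v q d e :
  q \is d.-homog for mdeg -> q * linp v ^+ e \is (d + e).-homog for mdeg.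
Proof.
move=> Hq; elim: e => [|e IH]; first by rewrite mulr1 addn0.
by rewrite exprSr mulrA -addn1 addnA dhomogM ?linp_homog.
Qed.

Lemma meval_linp v x : (linp v).@[x] = \sum_i v i * x i.
Proof. by rewrite raddf_sum; apply: eq_bigr => i _; rewrite /= mevalZ mevalXU. Qed.

Lemma mcoeff_linpr q v a : (q * linp v)@_a = \sum_i v i * mulU i (fun b => q@_b) a.
Proof.
rewrite mulr_sumr raddf_sum; apply: eq_bigr => i _.
by rewrite /= -scalerAr mcoeffZ mcoeffMU.
Qed.

Lemma fpoly_linp v : fpoly (linp v) = \sum_i fconst (v i) * fvar i.
Proof.
rewrite raddf_sum; apply: eq_bigr => i _ /=.
by rewrite -mul_mpolyC rmorphM /= fpolyC fpolyX.
Qed.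

Lemma fcoef_linpr (f : fps p A) v a :
  (f * fpoly (linp v)) a = \sum_i v i * mulU i f a.
Proof.
rewrite fpoly_linp mulr_sumr fcoef_sum; apply: eq_bigr => i _.
by rewrite mulrCA fcoefCM fcoefMU.
Qed.

(** The geometric series [1 / (1 - v)]: its part of degree [d] is [v ^ d]. *)
Definition geom v : fps p A := Fps (fun a => (linp v ^+ mdeg a)@_a).

Lemma fcoef_geomM v u a : a != 0%MM ->
  (geom v * fpoly (linp u)) a = (linp u * linp v ^+ (mdeg a).-1)@_a.
Proof.
move=> a0; rewrite fcoef_linpr mulrC mcoeff_linpr; apply: eq_bigr => i _.
congr (_ * _); rewrite /mulU; case: ifP => // ai /=.
by congr (_ ^+ _)@__; rewrite -(mdeg_subm1 ai).
Qed.

Lemma geomP v : geom v * (1 - fpoly (linp v)) = 1.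
Proof.
apply: fpsP => a; rewrite mulrBr mulr1 fcoefD fcoefN.
have [->|a0] := eqVneq a 0%MM.
  have -> : geom v 0%MM = 1 by rewrite /= mdeg0 expr0 mcoeff1 eqxx.
  rewrite fcoef_linpr big1 => [|i _]; last by rewrite mulU_eq0 ?mulr0 // mnm0E.
  by rewrite subr0 /= eqxx.
rewrite fcoef_geomM // -[fcoef (geom v) a]/((linp v ^+ mdeg a)@_a) -exprS prednK ?lt0n ?mdeg_eq0 //.
by rewrite subrr /= (negPf a0).
Qed.

(** [u / (1 - v)], for two linear forms. *)
Definition linfrac v u : fps p A := geom v * fpoly (linp u).

Lemma linfracP v u : (1 - fpoly (linp v)) * linfrac v u = fpoly (linp u).
Proof. by rewrite /linfrac mulrA [_ * geom v]mulrC geomP mul1r. Qed.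

Lemma linfrac0 v u : linfrac v u 0%MM = 0.
Proof.
by rewrite /linfrac fcoef_linpr big1 // => i _; rewrite mulU_eq0 ?mulr0 // mnm0E.
Qed.

(** Truncating the series in degree [d] truncates the geometric series. *)
Lemma linfrac_trunc v u d :
  \sum_(a : 'X_{1..p < d}) linfrac v u a *: 'X_[a] =
  \sum_(e < d.-1) linp u * linp v ^+ e.
Proof.
apply/mpolyP => a; have -> : (\sum_(e < d.-1) linp u * linp v ^+ e)@_a =
    \sum_(e < d.-1) (linp u * linp v ^+ e)@_a by rewrite raddf_sum.
rewrite mcoeff_sum_lt.
have hom e : linp u * linp v ^+ e \is (1 + e).-homog for mdeg.
  by apply: homog_linpX; apply: linp_homog.
have hom0 e b : (mdeg b != e.+1)%N -> (linp u * linp v ^+ e)@_b = 0.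
  exact: (dhomog_nemf_coeff (hom e)).
have [->|a0] := eqVneq a 0%MM.
  rewrite linfrac0 if_same big1 // => e _.
  by rewrite hom0 // mdeg0.
rewrite -mdeg_eq0 -lt0n in a0; case: ifP => ad.
  have L : ((mdeg a).-1 < d.-1)%N by lia.
  rewrite (bigD1 (Ordinal L)) // [X in _ = _ + X]big1 => [|e ne].
    by rewrite addr0 /= -fcoef_geomM // -mdeg_eq0 -lt0n.
  rewrite hom0 //; apply: contra ne => /eqP ae.
  by apply/eqP/val_inj; rewrite /= ae.
rewrite big1 // => e _; rewrite hom0 //.
by apply/negP => /eqP ae; have := ltn_ord e; move: ad; rewrite ae; lia.
Qed.

Lemma linfrac_partial v u d x :
  \sum_(a : 'X_{1..p < d}) linfrac v u a * \prod_(i < p) x i ^+ a i =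
  (\sum_i u i * x i) * \sum_(e < d.-1) (\sum_i v i * x i) ^+ e.
Proof.
have := congr1 (meval x) (linfrac_trunc v u d); rewrite !raddf_sum /= mulr_sumr => E.
rewrite (eq_bigr (fun e : 'I_d.-1 => meval x (linp u * linp v ^+ e))).
  2: by move=> e _; rewrite rmorphM rmorphXn /= !meval_linp.
by rewrite -E; apply: eq_bigr => a _; rewrite mevalZ mevalX.
Qed.

End LinearForms.

Section Analytic.
Variable R : realType.
Local Notation C := (R[i]).
Variable p : nat.
Implicit Types (v u : 'I_p -> C).

Lemma norm_mcoeffM (q r q' r' : {mpoly C[p]}) :
    (forall a, `|q@_a| <= q'@_a) -> (forall a, `|r@_a| <= r'@_a) ->
  forall a, `|(q * r)@_a| <= (q' * r')@_a.
Proof.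
move=> Hq Hr a; rewrite !mcoeffM (le_trans (ler_norm_sum _ _ _)) //.
by apply: ler_sum => k _; rewrite normrM ler_pM.
Qed.

Lemma norm_linp v a : `|(linp v)@_a| <= (linp (fun i => `|v i|))@_a.
Proof.
rewrite !raddf_sum (le_trans (ler_norm_sum _ _ _)) //; apply: ler_sum => i _ /=.
by rewrite !mcoeffZ mcoeffX normrM normr_nat.
Qed.

(** The series with the moduli of the coefficients is a majorant, so absolute
    convergence reduces to the real geometric series. *)
Lemma norm_linfrac v u a :
  `|linfrac v u a| <= linfrac (fun i => `|v i|) (fun i => `|u i|) a.
Proof.
have [->|a0] := eqVneq a 0%MM; first by rewrite !linfrac0 normr0.
rewrite !fcoef_geomM //; apply: norm_mcoeffM => b; first exact: norm_linp.
elim: (mdeg a).-1 b => [|e IH] b; first by rewrite mcoeff1 normr_nat.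
by rewrite !exprS; apply: norm_mcoeffM => // c; apply: norm_linp.
Qed.

Lemma near_small (d : C) (P : 'rV[C]_p -> Prop) : 0 < d ->
    (forall Z : 'rV[C]_p, (forall i, `|Z 0 i| < d) -> P Z) ->
  \forall Z \near (0 : 'rV[C^o]_p), P Z.
Proof.
move=> d0 H; apply/nbhs_ballP; exists d => //= Z [_ HZ]; apply: H => i.
by have := HZ 0 i; rewrite /ball /= mxE sub0r normrN.
Qed.

(** The bound 1/2 keeps the geometric series and its pole under control. *)
Lemma small_linear v : exists2 d : C, 0 < d &
  forall Z : 'rV[C]_p, (forall i, `|Z 0 i| < d) -> \sum_i `|v i| * `|Z 0 i| <= 2^-1.
Proof.
pose s := 1 + \sum_i `|v i|.
have s0 : 0 < s by rewrite ltr_pwDl // sumr_ge0.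
exists ((2 * s)^-1) => [|Z HZ]; first by rewrite invr_gt0 mulr_gt0.
rewrite (le_trans (y := \sum_i `|v i| * (2 * s)^-1)) //.
  by apply: ler_sum => i _; rewrite ler_wpM2l // ltW.
rewrite -mulr_suml invfM mulrCA ger_pMr ?invr_gt0 //.
by rewrite ler_pdivrMr // mul1r /s lerDr.
Qed.

Lemma expr_half_lt (M e : C) : 0 <= M -> 0 < e ->
  exists N, forall d, (N <= d)%N -> M * 2^-1 ^+ d < e.
Proof.
move=> M0 e0; have r0 : 0 <= M / e by rewrite divr_ge0 // ltW.
have [N HN] : exists N : nat, M / e < N%:R.
  have /complex_realP[x xE] := ger0_real r0.
  exists (Num.bound x); rewrite xE -(rmorph_nat (real_complex R)) ltcR archi_boundP //.
  by rewrite -lecR -xE.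
exists N => d Nd; rewrite exprVn ltr_pdivrMr ?exprn_gt0 // mulrC -ltr_pdivrMr //.
rewrite (lt_trans HN) // -natrX ltr_nat (leq_ltn_trans Nd) // ltn_expl //.
Qed.

(** Where [sum |v_i Z_i| <= 1/2], the partial sums of the moduli are at most
    [2 sum |u_i Z_i|], and the remainder decays like [2^-d]. *)
Lemma taylor0_linfrac v u :
  taylor0 (fun Z => (\sum_i u i * Z 0 i) / (1 - \sum_i v i * Z 0 i)) (linfrac v u).
Proof.
have [d d0 Hd] := small_linear v.
apply: (near_small d0) => Z /Hd vZ.
have half0 : (0 : C) <= 2^-1 by rewrite invr_ge0.
have half1 : (2^-1 : C) < 1 by rewrite invf_lt1 ?ltr1n.
have geomE (x : C) N : x != 1 -> \sum_(e < N) x ^+ e = (1 - x ^+ N) / (1 - x).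
  move=> x1; have x1' : 1 - x != 0 by rewrite subr_eq0 eq_sym.
  by apply: (mulIf x1'); rewrite divfK // mulrC -[1 - x ^+ N]opprB subrX1 -mulNr opprB.
have half_sum N : \sum_(e < N) (2^-1 : C) ^+ e <= 2.
  rewrite geomE ?lt_eqF // (_ : 1 - 2^-1 = 2^-1 :> C); last by field.
  by rewrite invrK ger_pMl // gerBl exprn_ge0.
split.
  exists ((\sum_i `|u i| * `|Z 0 i|) * 2) => D.
  apply: (@le_trans _ _ (\sum_(a : 'X_{1..p < D})
     linfrac (fun i => `|v i|) (fun i => `|u i|) a * \prod_(i < p) `|Z 0 i| ^+ a i)).
    apply: ler_sum => a _; rewrite /fterm normrM normr_prod.
    rewrite (eq_bigr (fun i => `|Z 0 i| ^+ bmnm a i)) => [|i _]; last by rewrite normrX.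
    by rewrite ler_wpM2r ?norm_linfrac // prodr_ge0 // => i _; rewrite exprn_ge0.
  rewrite linfrac_partial ler_wpM2l ?sumr_ge0 // => [i _|]; first by rewrite mulr_ge0.
  apply: le_trans (half_sum D.-1); apply: ler_sum => e _.
  by rewrite lerXn2r ?nnegrE // sumr_ge0 // => i _; rewrite mulr_ge0.
set x := \sum_i v i * Z 0 i.
have nx : `|x| <= 2^-1.
  by rewrite (le_trans (ler_norm_sum _ _ _)) //; under eq_bigr do rewrite normrM.
have x1 : x != 1 by apply: contraTneq nx => ->; rewrite normr1; apply/negP => /(lt_le_trans half1); rewrite ltxx.
have dx : 2^-1 <= `|1 - x|.
  have := lerB_dist 1 x; rewrite normr1; apply: le_trans.
  by rewrite lerBrDr -lerBrDl (le_trans nx) // -subr_ge0 (_ : _ - _ = 0 :> C) //; field.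
set y := \sum_i u i * Z 0 i.
apply/(@cvg_ballP C (C^o : pseudoMetricType C)) => e e0.
have [N HN] := expr_half_lt (M := `|y| * 2) (mulr_ge0 (normr_ge0 _) (ler0n _ 2)) e0.
exists N.+1 => // D /= ND; rewrite /ball /=.
have -> : \sum_(a : 'X_{1..p < D}) fterm (linfrac v u) Z a =
    y * \sum_(i < D.-1) x ^+ i by rewrite -linfrac_partial.
rewrite geomE // (_ : _ - _ = y * x ^+ D.-1 / (1 - x)); last first.
  by field; rewrite subr_eq0 eq_sym.
rewrite !normrM normfV normrX (le_lt_trans _ (HN D.-1 _)); last by lia.
  done.
rewrite mulrAC ler_pM ?mulr_ge0 ?invr_ge0 ?exprn_ge0 //.
  rewrite ler_wpM2l // -[leRHS]invrK lef_pV2 ?posrE ?invr_gt0 //.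
  by rewrite (lt_le_trans _ dx) // invr_gt0.
by rewrite lerXn2r ?nnegrE.
Qed.

End Analytic.

(** * Germs of linear fractional maps *)

Section LinearFractional.
Variable R : realType.
Local Notation C := (R[i]).
Variable p : nat.
Implicit Types (A : 'M[C]_p) (b : 'cV[C]_p) (Z : 'rV[C]_p).

Definition lf A b Z : 'rV[C]_p := (1 - (Z *m b) 0 0)^-1 *: (Z *m A).

Definition lfser A b : 'rV[fps p C]_p :=
  \row_j linfrac (fun i => b i 0) (fun i => A i j).

Lemma lf0 A b : lf A b 0 = 0.
Proof. by rewrite /lf !mul0mx scaler0. Qed.

Lemma taylor0v_lf A b : taylor0v (lf A b) (lfser A b).
Proof.
move=> j; rewrite mxE (_ : (fun Z => lf A b Z 0 j) =
    (fun Z => (\sum_i A i j * Z 0 i) / (1 - \sum_i b i 0 * Z 0 i))).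
  exact: taylor0_linfrac.
apply/funext => Z; rewrite !mxE [RHS]mulrC; congr (_ * _).
  by congr (_ - _)^-1; apply: eq_bigr => i _; rewrite mulrC.
by apply: eq_bigr => i _; rewrite mulrC.
Qed.

(** In homogeneous coordinates [lf A b] is the linear map
    [(t, Z) |-> (t - Z b, Z A)]; the parameters below are those of its inverse. *)
Lemma lfK A A' b Z : A *m A' = 1%:M -> 1 - (Z *m b) 0 0 != 0 ->
  lf A' (- (A' *m b)) (lf A b Z) = Z.
Proof.
move=> AA' D0; set D := 1 - _ in D0; set P := lf A b Z.
have PA : P *m A' = D^-1 *: Z by rewrite /P /lf -scalemxAl -mulmxA AA' mulmx1.
have Pb : (P *m - (A' *m b)) 0 0 = - (D^-1 * (1 - D)).
  rewrite mulmxN mulmxA PA -scalemxAl !mxE; congr (- (_ * _)).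
  by rewrite /D opprB addrC subrK mxE.
rewrite [LHS]/lf PA Pb scalerA opprK mulrBr mulr1 mulVf // addrC subrK.
by rewrite invrK mulfV // scale1r.
Qed.

Lemma lf_pole_near b : \forall Z \near (0 : 'rV[C^o]_p), 1 - (Z *m b) 0 0 != 0.
Proof.
have [d d0 Hd] := small_linear (fun i => b i 0).
apply: (near_small d0) => Z /Hd bZ; rewrite subr_eq0; apply/negP => /eqP E.
have : `|(Z *m b) 0 0| <= 2^-1.
  rewrite mxE (le_trans (ler_norm_sum _ _ _)) //.
  by under eq_bigr do rewrite normrM mulrC.
rewrite -E normr1 => H; have : (2^-1 : C) < 1 by rewrite invf_lt1 ?ltr1n.
by move/(le_lt_trans H); rewrite ltxx.
Qed.

Lemma biholo_germ_lf A b : A \in unitmx -> biholo_germ (lf A b) (lfser A b).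
Proof.
move=> Au; pose b' := - (invmx A *m b).
split; [exact: lf0 | exact: taylor0v_lf |].
exists (lf (invmx A) b'), (lfser (invmx A) b').
split; [exact: lf0 | exact: taylor0v_lf |].
apply: filterS2 (lf_pole_near b) (lf_pole_near b') => Z D D'.
split; first by rewrite lfK // mulmxV.
have := lfK (mulVmx Au) D'.
by rewrite /b' mulmxN opprK mulKVmx.
Qed.

(** Substitution of series without constant term in a linear fractional map. *)
Variables (n : nat) (H : 'rV[fps n C]_p).
Hypothesis H0 : forall j, H 0 j 0%MM = 0.

Lemma fsubst_linp (v : 'I_p -> C) :
  fsubst H0 (fpoly (linp v)) = \sum_i H 0 i * fconst (v i).
Proof.
rewrite fpoly_linp rmorph_sum; apply: eq_bigr => i _.
by rewrite rmorphM /= fsubstC fsubstX mulrC.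
Qed.

Let D b : fps n C := 1 - (H *m map_mx fconst b) 0 0.

Lemma fsubst_denom b : fsubst H0 (1 - fpoly (linp (fun i => b i 0))) = D b.
Proof.
rewrite rmorphB rmorph1 [X in _ - X]fsubst_linp /D mxE; congr (_ - _).
by apply: eq_bigr => i _; rewrite mxE.
Qed.

(** The composition is computed without division: [D] is the value of the
    denominator on [H]. *)
Lemma fcompv_lfser A b :
  D b *: fcompv (lfser A b) H = H *m map_mx fconst A.
Proof.
apply/rowP => j; rewrite !mxE -fsubst_denom.
rewrite -[fcomp _ H]/(fsubst H0 _) -rmorphM linfracP [LHS]fsubst_linp.
by apply: eq_bigr => i _; rewrite mxE.
Qed.

Lemma denom_inv b : exists E, E * D b = 1.
Proof.
exists (fsubst H0 (geom (fun i => b i 0))).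
by rewrite -fsubst_denom -rmorphM geomP rmorph1.
Qed.

End LinearFractional.

Lemma lfser_hq_aut (R : realType) (l m : nat) (A : 'M[R[i]]_(m + 1)) (b : 'cV[R[i]]_(m + 1)) :
    A \in unitmx ->
    (forall Z, 1 - (Z *m b) 0 0 != 0 ->
       hyperquadric R l m Z <-> hyperquadric R l m (lf A b Z)) ->
  hq_aut R l m (lfser A b).
Proof.
move=> Au HZ; exists (lf A b); split; first exact: biholo_germ_lf.
by apply: filterS (lf_pole_near b) => Z /HZ.
Qed.

(** * Linear fractional automorphisms of the hyperquadric *)

Section Invariance.
Variables (S : comNzRingType) (l N : nat).
Implicit Types (x y : 'rV[S]_N).

Lemma sformC x y : sform l x y = sform l y x.
Proof. by rewrite !sformE; apply: eq_bigr => j _; rewrite [x 0 j * _]mulrC. Qed.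

Lemma sformDl x x' y : sform l (x + x') y = sform l x y + sform l x' y.
Proof.
by rewrite !sformE -big_split; apply: eq_bigr => j _; rewrite mxE /=; ring.
Qed.

Lemma sformZl c x y : sform l (c *: x) y = c * sform l x y.
Proof.
by rewrite !sformE mulr_sumr; apply: eq_bigr => j _; rewrite mxE; ring.
Qed.

Lemma sformDr x y y' : sform l x (y + y') = sform l x y + sform l x y'.
Proof. by rewrite sformC sformDl ![sform l _ x]sformC. Qed.
Lemma sformZr c x y : sform l x (c *: y) = c * sform l x y.
Proof. by rewrite sformC sformZl sformC. Qed.

(** The polarized form of the classical automorphism
    [(x + y a, y) / (1 - 2 i <x, a*> - (r + i <a, a>) y)] of the hyperquadric: the
    cross terms created by [x + y a] are those of the denominators [D] and [E]. *)
Lemma heisenberg_invariance (kap I : S) (x xi a a' : 'rV[S]_N) (y eta r : S) :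
    kap * (2 * I) = 1 ->
  let q := sform l a a' in
  let D := 1 - (2 * I * sform l x a' + y * (r + I * q)) in
  let E := 1 - (- (2 * I) * sform l xi a + eta * (r - I * q)) in
  kap * (y * E - eta * D) - sform l (x + y *: a) (xi + eta *: a') =
  kap * (y - eta) - sform l x xi.
Proof.
move=> kI q D E; rewrite !(sformDl, sformDr, sformZl, sformZr) (sformC a xi) -/q.
set u := sform l x a'; set v := sform l xi a.
have -> : kap * (y * E - eta * D) =
    kap * (y - eta) + kap * (2 * I) * (y * v + eta * u + y * eta * q).
  by rewrite /E /D -/u -/v; ring.
by rewrite kI; ring.
Qed.

Lemma polar_rhoZ (kap : S) (D E : S) (P Q : 'rV[S]_(N + 1)) :
  kap * (rsubmx (D *: P) 0 0 * E - rsubmx (E *: Q) 0 0 * D)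
    - sform l (lsubmx (D *: P)) (lsubmx (E *: Q)) =
  D * E * polar_rho kap l P Q.
Proof. by rewrite /polar_rho !linearZ /= sformZl sformZr !mxE; ring. Qed.

End Invariance.

Section Automorphism.
Variables (R : realType) (l N : nat).
Local Notation C := (R[i]).
Variables (V : 'M[C]_N) (a : 'rV[C]_N) (t r : C).
Hypotheses (VJ : V *m Jmx C l N *m (map_mx Num.conj V)^T = t *: Jmx C l N).
Hypotheses (tR : t^* = t) (rR : r^* = r).

Let ab := map_mx Num.conj a.

(** The numerator and the denominator of the automorphism
    [(x V + t y a, t y) / (1 - 2 i <x V, a*> - t (r + i <a, a>) y)], where [V]
    multiplies the form by [t]. *)
Definition heis_mx : 'M[C]_(N + 1) := block_mx V 0 (t *: a) t%:M.
Definition heis_den : 'cV[C]_(N + 1) :=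
  col_mx ((2 * 'i) *: (V *m Jmx C l N *m ab^T)) (t * (r + 'i * sform l a ab))%:M.

Section Morph.
Variables (S : comNzRingType) (io : {rmorphism C -> S}).
Variables (X Y P Q : 'rV[S]_(N + 1)).
Let D := 1 - (X *m map_mx io heis_den) 0 0.
Let E := 1 - (Y *m map_mx io (map_mx Num.conj heis_den)) 0 0.
Hypotheses (DP : D *: P = X *m map_mx io heis_mx)
  (EQ : E *: Q = Y *m map_mx io (map_mx Num.conj heis_mx)).

Let map_conj_J : map_mx Num.conj (Jmx C l N) = Jmx C l N.
Proof. by apply/matrixP => i j; rewrite !mxE rmorphMn /= rmorph_signl. Qed.

Let map_J : map_mx io (Jmx C l N) = Jmx S l N.
Proof. by apply/matrixP => i j; rewrite !mxE rmorphMn /= rmorph_signl. Qed.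

Let x := lsubmx X *m map_mx io V.
Let xi := lsubmx Y *m map_mx io (map_mx Num.conj V).
Let y := io t * rsubmx X 0 0.
Let eta := io t * rsubmx Y 0 0.

Let XA : X *m map_mx io heis_mx = row_mx (x + y *: map_mx io a) y%:M.
Proof.
rewrite -[X in X *m _]hsubmxK map_block_mx mul_row_block map_mx0 mulmx0 add0r.
rewrite [rsubmx X]mx11_scalar map_scalar_mx -scalar_mxM mulrC; congr (row_mx (_ + _) _).
by rewrite mul_scalar_mx map_mxZ scalerA mulrC.
Qed.

Let YA : Y *m map_mx io (map_mx Num.conj heis_mx) = row_mx (xi + eta *: map_mx io ab) eta%:M.
Proof.
rewrite -[X in X *m _]hsubmxK !map_block_mx mul_row_block !map_mx0 mulmx0 add0r.
rewrite [rsubmx Y]mx11_scalar !map_scalar_mx /= tR -scalar_mxM mulrC; congr (row_mx (_ + _) _).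
by rewrite mul_scalar_mx !map_mxZ /= tR scalerA mulrC.
Qed.

Let DE : D = 1 - (2 * io 'i * sform l x (map_mx io ab) +
  y * (io r + io 'i * sform l (map_mx io a) (map_mx io ab))).
Proof.
rewrite /D -[X in X *m _]hsubmxK map_col_mx mul_row_col mxE; congr (1 - (_ + _)).
  rewrite map_mxZ !map_mxM map_J map_trmx -scalemxAr mxE rmorphM rmorph_nat.
  by rewrite sform_mx !mulmxA /x /ab !map_trmx.
rewrite [rsubmx X]mx11_scalar map_scalar_mx -scalar_mxM mxE mulr1n /y.
rewrite rmorphM rmorphD rmorphM; rewrite (_ : io (sform l a ab) = sform l (map_mx io a) (map_mx io ab)).
  by ring.
by rewrite !sformE rmorph_sum; apply: eq_bigr => j _; rewrite !rmorphM rmorph_signl !mxE.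
Qed.

Let EE : E = 1 - (- (2 * io 'i) * sform l xi (map_mx io a) +
  eta * (io r - io 'i * sform l (map_mx io a) (map_mx io ab))).
Proof.
rewrite /E -[X in X *m _]hsubmxK !map_col_mx mul_row_col mxE; congr (1 - (_ + _)).
  rewrite !map_mxZ !map_mxM /= map_conj_J map_J !map_trmx -scalemxAr mxE rmorphM /= conjCi.
  rewrite rmorph_nat mulrN rmorphN rmorphM rmorph_nat.
  have -> : map_mx Num.conj (map_mx Num.conj a^T) = a^T.
    by apply/matrixP => i j; rewrite !mxE conjCK.
  by rewrite sform_mx !mulmxA /xi !map_trmx.
rewrite [rsubmx Y]mx11_scalar !map_scalar_mx -scalar_mxM mxE mulr1n /eta /=.
rewrite rmorphM /= tR rmorphD /= rR [('i * _)^*]rmorphM /= conjCi.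
have -> : (sform l a ab)^* = sform l a ab by exact: herm_conj.
rewrite rmorphM rmorphD rmorphM rmorphN.
rewrite (_ : io (sform l a ab) = sform l (map_mx io a) (map_mx io ab)).
  by ring.
by rewrite !sformE rmorph_sum; apply: eq_bigr => j _; rewrite !rmorphM rmorph_signl !mxE.
Qed.

(** [P = X A / D] and [Q = Y A* / E] are stated without division, so that they
    can be points as well as power series. *)
Lemma polar_rho_heis :
  D * E * polar_rho (io (kapC R)) l P Q = io t * polar_rho (io (kapC R)) l X Y.
Proof.
rewrite -polar_rhoZ DP EQ XA YA !row_mxKl !row_mxKr !mxE !mulr1n EE DE.
rewrite (heisenberg_invariance l x xi (map_mx io a) (map_mx io ab)).
  rewrite /polar_rho [RHS]mulrBr /y /eta; congr (_ - _); first by ring.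
  rewrite !sform_mx /x /xi trmx_mul !mulmxA -!(mulmxA (lsubmx X)).
  rewrite -map_J map_trmx -!map_mxM mulmxA VJ map_mxZ map_J.
  by rewrite -scalemxAr -scalemxAl mxE mulmxA.
have -> : 2 * io 'i = io (2 * 'i) by rewrite rmorphM rmorph_nat.
by rewrite -rmorphM kapC2i rmorph1.
Qed.

End Morph.

Lemma hyperquadricE Z :
  hyperquadric R l N Z <-> polar_rho (kapC R) l Z (map_mx Num.conj Z) = 0.
Proof.
rewrite /hyperquadric /polar_rho /=.
have -> : 'Im (rsubmx Z 0 0) =
    kapC R * (rsubmx Z 0 0 - rsubmx (map_mx Num.conj Z) 0 0).
  rewrite ImE !mxE /kapC invfM invCi; ring.
rewrite map_lsubmx; split=> [->|/eqP]; first by rewrite subrr.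
by rewrite subr_eq0 => /eqP.
Qed.

Lemma heis_preserves Z : t != 0 -> 1 - (Z *m heis_den) 0 0 != 0 ->
  hyperquadric R l N Z <-> hyperquadric R l N (lf heis_mx heis_den Z).
Proof.
move=> t0 D0; rewrite !hyperquadricE; set X := Z; set Y := map_mx Num.conj Z.
set P := lf _ _ _; set Q := map_mx Num.conj P.
have DP : (1 - (X *m map_mx idfun heis_den) 0 0) *: P = X *m map_mx idfun heis_mx.
  by rewrite !map_mx_id // /P /lf scalerA mulfV // scale1r.
have cD : 1 - (Y *m map_mx idfun (map_mx Num.conj heis_den)) 0 0 = (1 - (Z *m heis_den) 0 0)^*.
  by rewrite map_mx_id // -map_mxM mxE rmorphB rmorph1.
have EQ : (1 - (Y *m map_mx idfun (map_mx Num.conj heis_den)) 0 0) *: Q =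
    Y *m map_mx idfun (map_mx Num.conj heis_mx).
  rewrite cD map_mx_id // -map_mxM /Q -map_mxZ; congr map_mx.
  by rewrite /P /lf scalerA mulfV // scale1r.
have := polar_rho_heis DP EQ; rewrite cD map_mx_id //= => E.
have U : (1 - (X *m heis_den) 0 0) * (1 - (Z *m heis_den) 0 0)^* != 0.
  by rewrite mulf_neq0 // conjC_eq0.
split=> H.
  by apply: (mulfI U); rewrite E H !mulr0.
by apply: (mulfI t0); rewrite -E H !mulr0.
Qed.

Lemma heis_mx_unit : t != 0 -> V \in unitmx -> heis_mx \in unitmx.
Proof.
move=> t0; rewrite !unitmxE det_lblock det_scalar1 unitrM => ->.
by rewrite unitfE.
Qed.

End Automorphism.

(** * The half turn of the coordinates *)

Section HalfTurn.
Variable l : nat.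
Local Notation n := (l + l)%N.

Fact half_turn_subproof (t : 'I_n) : ((if t < l then t + l else t - l) < n)%N.
Proof. by have := ltn_ord t; case: ifP; lia. Qed.

(** The permutation of the indices effected by [rot l]. *)
Definition half_turn (t : 'I_n) : 'I_n := Ordinal (half_turn_subproof t).

Lemma half_turnK : involutive half_turn.
Proof.
move=> t; apply: val_inj => /=; have := ltn_ord t.
by case: (ltnP t l) => tl; case: ifP; lia.
Qed.

Lemma signl_half_turn (S : pzRingType) t : signl S l (half_turn t) = - signl S l t.
Proof.
rewrite /signl /=; have := ltn_ord t; case: (ltnP t l) => tl; case: ifP => //; try lia.
by rewrite opprK.
Qed.

Lemma sum_signl (S : numDomainType) : \sum_(t < n) signl S l t = 0.
Proof.
have E : \sum_(t < n) signl S l t = - \sum_(t < n) signl S l t.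
  rewrite {1}(reindex_inj (inv_inj half_turnK)) -sumrN; apply: eq_bigr => t _.
  exact: signl_half_turn.
by apply/eqP; rewrite -[_ == 0](mulrn_eq0 _ 2) mulr2n {1}E addNr.
Qed.

Lemma nth_rot_half (T : Type) (x0 : T) (f : 'I_n -> T) (j : 'I_n) :
  nth x0 (rot l [seq f i | i <- enum 'I_n]) j = f (half_turn j).
Proof.
have sz : size [seq f i | i <- enum 'I_n] = n by rewrite size_map size_enum_ord.
have E (i : nat) (Hi : (i < n)%N) : nth x0 [seq f i | i <- enum 'I_n] i = f (Ordinal Hi).
  rewrite (nth_map (Ordinal Hi)) ?size_enum_ord //; congr f; apply: val_inj.
  by rewrite /= nth_enum_ord.
have := ltn_ord j; rewrite /rot nth_cat size_drop sz addnK => jn.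
case: (ltnP j l) => jl.
  have H : (l + j < n)%N by lia.
  by rewrite nth_drop (E _ H); congr f; apply: val_inj; rewrite /= jl addnC.
have H : (j - l < n)%N by lia.
rewrite nth_take; last by lia.
by rewrite (E _ H); congr f; apply: val_inj; rewrite /= ltnNge jl.
Qed.

End HalfTurn.

(** * Normalization of a formal embedding *)

Section Target.
Variables (R : realType) (l n k : nat).
Local Notation C := (R[i]).
Local Notation w := (rshift n (ord0 : 'I_1)).
Local Notation z t := (lshift 1 t).
Variables (s : C) (rho : 'I_n -> 'I_n).
Hypotheses (ln : (l <= n)%N) (n0 : (0 < n)%N).
Hypotheses (s2 : s * s = 1) (sR : s^* = s) (rhoK : involutive rho).
Hypothesis rhoS : forall t, signl C l (rho t) = s * signl C l t.
Hypothesis trace0 : \sum_(t < n) signl C l t = 0.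

Lemma signl_lshift (j : 'I_n) : signl C l (lshift k j) = signl C l j.
Proof. by []. Qed.
Lemma signl_rshift (j : 'I_k) : signl C l (rshift n j) = 1.
Proof. by rewrite /signl /= ltnNge (leq_trans ln) ?leq_addr. Qed.

Variables (H : 'rV[fps (n + 1) C]_(n + k + 1)) (g : fps (n + 1 + (n + 1)) C).

Hypothesis H_id : polar_rho (fconst (kapC R)) l (map_mx (@holo R (n + 1)) H)
  (map_mx (@anti R (n + 1)) H) = g * hq_rho R l n.
Hypothesis H0 : forall j, H 0 j 0%MM = 0.
Hypothesis Hz : forall (j : 'I_n) t, H 0 (lshift 1 (lshift k j)) U_(z t)%MM = (j == rho t)%:R.
Hypothesis Hzn : forall (j : 'I_k) t, H 0 (lshift 1 (rshift n j)) U_(z t)%MM = 0.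
Hypothesis Hw : forall j : 'I_(n + k), H 0 (lshift 1 j) U_(w)%MM = 0.
Hypothesis Hww : H 0 (rshift (n + k) ord0) U_(w)%MM = s.
Hypothesis Hw2 : H 0 (rshift (n + k) ord0) (U_(w) + U_(w))%MM +
  (H 0 (rshift (n + k) ord0) (U_(w) + U_(w))%MM)^* = 0.

(** The two normal forms come from one application of [normalized_rigidity], with
    [f_t] the component of index [rho t]. *)
Lemma rigid_target :
  [/\ forall j, H 0 (lshift 1 (lshift k j)) = fvar (z (rho j)),
      forall j, H 0 (lshift 1 (rshift n j)) = 0
    & H 0 (rshift (n + k) ord0) = fconst s * fvar w].
Proof.
have s0 : s != 0 by apply/eqP => s0; move/eqP: s2; rewrite s0 mul0r eq_sym oner_eq0.
have [] := @normalized_rigidity C n k (kapC R) s (fun t => s * signl C l t)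
  (kapC_neq0 R) s0 _ n0 sR _
  (fun t => H 0 (lshift 1 (lshift k (rho t)))) (fun j => H 0 (lshift 1 (rshift n j)))
  (H 0 (rshift (n + k) ord0)) (fun a b => s * g (mjoin a b)).
- by move=> t; rewrite mulf_neq0 // /signl; case: ifP; rewrite ?oppr_eq0 oner_eq0.
- by rewrite -mulr_sumr trace0 mulr0.
- move=> a b.
  have -> : rhoM (kapC R) s (fun t => s * signl C l t) (fun a b => s * g (mjoin a b)) a b =
     rhoM (kapC R) 1 (@signl C l n) (fun a b => g (mjoin a b)) a b.
    have E i X c : mulU i (fun a => s * X a : C) c = s * mulU i X c.
      by rewrite /mulU; case: ifP; rewrite ?mulr0.
    rewrite /rhoM !E -mulrBr mulrA -[kapC R * s * s]mulrA s2; congr (_ - _).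
    apply: eq_bigr => t _.
    have -> : mulUU t (fun a b => s * g (mjoin a b)) a b = s * mulUU t (fun a b => g (mjoin a b)) a b.
      by rewrite /mulUU -E; apply: eq_mulU => a'; rewrite E.
    by rewrite mulrACA s2 mul1r.
  rewrite -fcoefM_hq_rho -H_id fcoef_polar_rho -addrA -opprD; congr (_ - _).
  rewrite big_split_ord /=; congr (_ + _).
    rewrite [RHS](reindex_inj (inv_inj rhoK)); apply: eq_bigr => t _.
    by rewrite signl_lshift rhoS !mulrA.
  by apply: eq_bigr => j _; rewrite signl_rshift mul1r.
- exact: H0.
- by move=> t; exact: H0.
- by move=> t; exact: H0.
- by move=> t t'; rewrite Hz (inj_eq (inv_inj rhoK)).
- exact: Hzn.
- by move=> t; exact: Hw.
- by move=> t; exact: Hw.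
- exact: Hww.
- exact: Hw2.
move=> Hf Hphi HG; split.
- by move=> j; apply: fpsP => m; rewrite -[j in LHS]rhoK Hf /=.
- by move=> j; apply: fpsP => m; rewrite Hphi.
by apply: fpsP => m; rewrite HG fcoefCM.
Qed.

End Target.

Section NormalForm.
Variables (R : realType) (l n k : nat).
Local Notation C := (R[i]).
Local Notation w := (rshift n (ord0 : 'I_1)).
Local Notation z t := (lshift 1 t).
Hypotheses (ln : (l < n)%N).
Variable H : 'rV[fps (n + 1) C]_(n + k + 1).
Hypothesis H_emb : formal_embedding (hq_rho R l n) (hq_rho R l (n + k)) H.

Let G := H 0 (rshift (n + k) ord0).
Let c := G U_(w)%MM.
Let Fz (t : 'I_n) : 'rV[C]_(n + k) := \row_j H 0 (lshift 1 j) U_(z t)%MM.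
Let Fw : 'rV[C]_(n + k) := \row_j H 0 (lshift 1 j) U_(w)%MM.

Lemma emb_coef0 j : H 0 j 0%MM = 0. Proof. by case: H_emb. Qed.

(** The mapping identity, in a form in which coefficients can be compared. *)
Lemma emb_polar_rho : exists g, polar_rho (fconst (kapC R)) l (map_mx (@holo R (n + 1)) H)
  (map_mx (@anti R (n + 1)) H) = g * hq_rho R l n.
Proof.
by case: H_emb => _ _ [g E]; exists g; rewrite -E fcomp_hq_rho //; apply: emb_coef0.
Qed.

Let delta0U i : delta0 C (U_(i)%MM : 'X_{1..n + 1}) = 0.
Proof. by rewrite /delta0 -mdeg_eq0 mdeg1. Qed.
Let delta00 : delta0 C (0%MM : 'X_{1..n + 1}) = 1.
Proof. by rewrite /delta0 eqxx. Qed.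
Let mulU_U (f : 'X_{1..n + 1} -> C) i j : mulU i f U_(j)%MM = f 0%MM *+ (i == j).
Proof.
rewrite /mulU mnm1E eq_sym; case: eqP => [->|]; last by rewrite mulr0n.
by rewrite mulr1n -[X in (X - _)%MM]add0m addmK.
Qed.

(** These are the coefficients of [z_i], of [w] and [tau], and of [z_i chi_j] in
    the mapping identity. *)
Lemma first_jet : [/\ forall t, G U_(z t)%MM = 0, c^* = c
  & forall i j, herm l (Fz i) (Fz j) = (c * signl C l i) *+ (i == j)].
Proof.
have [g E] := emb_polar_rho.
have I a b := etrans (esym (fcoef_polar_rho l H a b)) (etrans (congr1 (fun f => fcoef f (mjoin a b)) E) (fcoefM_hq_rho l g a b)).
have G0 : G 0%MM = 0 by exact: emb_coef0.
have zw t : (z t == w) = false by rewrite neq_zw.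
have wz t : (w == z t) = false by rewrite eq_sym neq_zw.
have b0 a : kapC R * G a = kapC R * mulU w (fun a => g (mjoin a 0)) a.
  have := I a 0%MM; rewrite rhoM_const mulr1 => <-; rewrite -/G G0 rmorph0 mulr0 delta00 mulr1 subr0.
  by rewrite big1 ?subr0 // => j _; rewrite emb_coef0 rmorph0 !mulr0.
have Gz t : G U_(z t)%MM = 0.
  by apply: (mulfI (kapC_neq0 R)); rewrite b0 mulU_U wz mulr0n mulr0.
have cE : c = g (mjoin 0 0).
  by apply: (mulfI (kapC_neq0 R)); rewrite b0 mulU_U eqxx.
split=> //.
  have := I 0%MM U_(w)%MM; rewrite -/G G0 delta0U mulr0 sub0r delta00 mul1r -/c.
  rewrite big1 ?subr0 => [|j _]; last by rewrite emb_coef0 mul0r mulr0.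
  rewrite /rhoM mulr1 mulU_eq0 ?mnm0E // mulU_U eqxx sub0r mulr1n -cE big1 => [|t _].
    by rewrite subr0 => /(mulfI (kapC_neq0 R)) /oppr_inj.
  by rewrite /mulUU mulU_eq0 ?mnm0E // mulr0.
move=> i j; have := I U_(z i)%MM U_(z j)%MM.
rewrite rhoM_w0 ?mnm1E ?neq_zw // !delta0U mulr0 mul0r subrr mulr0 sub0r => /oppr_inj.
rewrite hermE => E'; etransitivity; last (etransitivity; first exact: E').
  by apply: eq_bigr => t _; rewrite !mxE.
rewrite (bigD1 i) //= big1 => [|t ti].
  rewrite /mulUU mulU_U eqxx mulr1n mulU_U addr0 mulrC cE (inj_eq (@lshift_inj _ _)).
  by case: eqP => // _; rewrite ?mulr1n // !mulr0n mul0r.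
by rewrite /mulUU mulU_U (inj_eq (@lshift_inj _ _)) (negPf ti) mulr0n mulr0.
Qed.

(** If [c = 0], the image of the [z]-space is isotropic; as [l < n], it contains
    the image of some [v != 0] whose first [l] coordinates vanish.  The form is
    definite there, so [dH(0) v = 0]. *)
Lemma emb_transversal : c != 0.
Proof.
have [Gz cR FF] := first_jet; apply/eqP => c0.
have lN : (l <= n + k)%N by rewrite (leq_trans (ltnW ln)) // leq_addr.
pose M : 'M[C]_(n, n + k) := \matrix_t Fz t.
have [v v0 vM] := left_kernel (colsub (widen_ord lN) M) ln.
have MM : herm l (v *m M) (v *m M) = 0.
  rewrite mulmx_sum_row herm_suml big1 // => i _; rewrite hermZl herm_sumr big1 ?mulr0 // => j _.
  by rewrite hermZr !rowK FF c0 mul0r mul0rn mulr0.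
have vM0 : v *m M = 0.
  have pos (j : 'I_(n + k)) : (j < l)%N -> (v *m M) 0 j = 0.
    move=> jl; have := congr1 (fun X : 'rV_l => X 0 (Ordinal jl)) vM.
    rewrite mulmx_colsub !mxE => E; rewrite -[RHS]E; apply: eq_bigr => i _.
    by congr (_ * M i _); apply: val_inj.
  rewrite (herm_pos_coord pos) in MM.
  by apply/rowP => j; rewrite [RHS]mxE; apply: sum_sqr_eq0 MM j.
case: H_emb => _ inj _; have inj0 := inj (row_mx v 0) 0.
suff : row_mx v 0 *m fjac H = 0 *m fjac H.
  move=> E0; have := congr1 lsubmx (inj0 E0); rewrite row_mxKl => E.
  by move/eqP: v0; apply; rewrite E; apply/rowP => j; rewrite !mxE.
rewrite mul0mx -[fjac H]vsubmxK mul_row_col mul0mx addr0.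
apply/rowP => j; rewrite [RHS]mxE -(splitK j); case: (split j) => j' /=.
  have := congr1 (fun X : 'rV_(n + k) => X 0 j') vM0; rewrite !mxE => E.
  by rewrite -[RHS]E; apply: eq_bigr => i _; rewrite !mxE.
rewrite mxE big1 // => i _; rewrite !mxE [j']ord1 -/G.
by rewrite [G _]Gz mulr0.
Qed.

Variables (s : C) (rho : 'I_n -> 'I_n).
Hypotheses (s2 : s * s = 1) (sR : s^* = s) (rhoK : involutive rho).
Hypothesis rhoS : forall t, signl C l (rho t) = s * signl C l t.
Hypothesis trace0 : \sum_(t < n) signl C l t = 0.
Hypothesis sc : 0 < s * c.

(** [T] undoes the differential of [H] on the [z]-space, up to the permutation
    [rho]; its parameters [a] and [r] are then solved for from the coefficients
    of [w] in the first components and of [w^2] in the last one. *)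
Lemma normal_form : exists T : 'rV[fps (n + k + 1) C]_(n + k + 1),
  [/\ hq_aut R l (n + k) T,
      forall j, fcompv T H 0 (lshift 1 (lshift k j)) = fvar (z (rho j)),
      forall j, fcompv T H 0 (lshift 1 (rshift n j)) = 0
    & fcompv T H 0 (rshift (n + k) ord0) = fconst s * fvar w].
Proof.
have [Gz cR FF] := first_jet.
have nN : (n <= n + k)%N by rewrite leq_addr.
pose P : 'M[C]_(n, n + k) := \matrix_t Fz (rho t).
have HP i j : herm l (row i P) (row j P) = (s * c * signl C l i) *+ (i == j).
  by rewrite !rowK FF rhoS (inj_eq (inv_inj rhoK)); congr (_ *+ _); ring.
have [W WJ WP] := herm_extend (ltnW ln) nN sc HP.
have scn0 : s * c != 0 by rewrite lt0r_neq0.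
pose t := (s * c)^-1.
have t0 : t != 0 by rewrite invr_eq0.
have tR : t^* = t by rewrite fmorphV rmorphM /= sR cR.
pose J := Jmx C l (n + k).
(* [W] is invertible, since its Gram matrix is *)
have WX : W *m (t *: (J *m (map_mx Num.conj W)^T *m J)) = 1%:M.
  rewrite -scalemxAr !mulmxA WJ -scalemxAl JmxK scalerA mulVf // scale1r //.
have [Wu _] := mulmx1_unit WX.
pose V := invmx W.
have VJ : V *m J *m (map_mx Num.conj V)^T = t *: J.
  have cVW : (map_mx Num.conj W)^T *m (map_mx Num.conj V)^T = 1%:M.
    by rewrite -trmx_mul -map_mxM mulVmx // map_mx1 trmx1.
  have E : J *m (map_mx Num.conj W)^T = s * c *: (V *m J).
    by rewrite -[J in LHS](mulKmx Wu) -/V -!mulmxA [W *m _]mulmxA WJ -scalemxAr.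
  have E2 : V *m J = t *: (J *m (map_mx Num.conj W)^T).
    by rewrite E scalerA mulVf ?scale1r.
  by rewrite E2 -scalemxAl -mulmxA cVW mulmx1.
pose a := - s *: (Fw *m V).
pose r := - ((t * G (U_(w) + U_(w))%MM) + (t * G (U_(w) + U_(w))%MM)^*) / 2.
have rR : r^* = r.
  by rewrite /r rmorphM rmorphN rmorphD /= conjCK fmorphV rmorph_nat addrC.
have r2 : r * 2 = - (t * G (U_(w) + U_(w))%MM + (t * G (U_(w) + U_(w))%MM)^*).
  by rewrite /r divfK ?pnatr_eq0.
clearbody r.
pose A := heis_mx V a t; pose b := heis_den l V a t r.
have Au : A \in unitmx by rewrite heis_mx_unit // unitmx_inv.
exists (lfser A b); set H' := fcompv _ H.
have H0 := emb_coef0.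
pose D := 1 - (H *m map_mx fconst b) 0 0.
have DH : D *: H' = H *m map_mx fconst A := fcompv_lfser H0 A b.
clearbody H'.
have [iD iDD] := denom_inv H0 b; rewrite -/D in iDD.
have T_aut : hq_aut R l (n + k) (lfser A b).
  by apply: lfser_hq_aut => // Z; apply: heis_preserves.
have [g Hg] := emb_polar_rho.
have [g' Hg'] : exists g', polar_rho (fconst (kapC R)) l (map_mx (@holo R (n + 1)) H')
    (map_mx (@anti R (n + 1)) H') = g' * hq_rho R l n.
  have Dh : @holo R (n + 1) D = 1 - (map_mx (@holo R (n + 1)) H *m map_mx fconst b) 0 0.
    rewrite /D rmorphB rmorph1 !mxE rmorph_sum; congr (_ - _).
    by apply: eq_bigr => m _; rewrite rmorphM !mxE; congr (_ * _); exact: holoC.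
  have Da : @anti R (n + 1) D =
      1 - (map_mx (@anti R (n + 1)) H *m map_mx fconst (map_mx Num.conj b)) 0 0.
    rewrite /D rmorphB rmorph1 !mxE rmorph_sum; congr (_ - _).
    by apply: eq_bigr => m _; rewrite rmorphM !mxE; congr (_ * _); exact: antiC.
  have Ph : @holo R (n + 1) D *: map_mx (@holo R (n + 1)) H' =
      map_mx (@holo R (n + 1)) H *m map_mx fconst A.
    rewrite -map_mxZ DH map_mxM; congr (_ *m _).
    by apply/matrixP => i j; rewrite !mxE; exact: holoC.
  have Pa : @anti R (n + 1) D *: map_mx (@anti R (n + 1)) H' =
      map_mx (@anti R (n + 1)) H *m map_mx fconst (map_mx Num.conj A).
    rewrite -map_mxZ DH map_mxM; congr (_ *m _).
    by apply/matrixP => i j; rewrite !mxE; exact: antiC.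
  have E : holo D * anti D * polar_rho (fconst (kapC R)) l (map_mx (@holo R (n + 1)) H')
      (map_mx (@anti R (n + 1)) H') = fconst t * (g * hq_rho R l n).
    rewrite Dh in Ph; rewrite Da in Pa; rewrite Dh Da.
    etransitivity; first exact: (polar_rho_heis VJ tR rR Ph Pa).
    by congr (_ * _); exact: Hg.
  exists (holo iD * anti iD * fconst t * g).
  move: E; set X := polar_rho _ _ _ _; set Y := hq_rho R l n => E.
  have -> : holo iD * anti iD * fconst t * g * Y = holo iD * (anti iD * (fconst t * (g * Y))).
    by rewrite !mulrA.
  rewrite -E.
  have Ih : holo iD * holo D = 1 by rewrite -rmorphM iDD rmorph1.
  have Ia : anti iD * anti D = 1 by rewrite -rmorphM iDD rmorph1.
  have -> : holo iD * (anti iD * (holo D * anti D * X)) =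
      (holo iD * holo D) * (anti iD * anti D) * X by ring.
  by rewrite Ih Ia !mul1r.
(* [H' = H A + lam H'] and [lam] has no constant term, so the low order
   coefficients of [H'] are those of [H A], up to a product at order two *)
pose lam := (H *m map_mx fconst b) 0 0.
have coefHM m' (M : 'M[C]_(n + k + 1, m')) j m :
    (H *m map_mx fconst M) 0 j m = ((\row_i H 0 i m) *m M) 0 j.
  rewrite !mxE fcoef_sum; apply: eq_bigr => i _; rewrite !mxE mulrC fcoefCM; ring.
have H'E j : H' 0 j = (H *m map_mx fconst A) 0 j + lam * H' 0 j.
  by rewrite -DH mxE /D -/lam mulrBl mul1r subrK.
have row0 : \row_i H 0 i 0%MM = 0 by apply/rowP => j; rewrite !mxE H0.
have lam0 : lam 0%MM = 0 by rewrite /lam coefHM row0 mul0mx mxE.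
have H'0 j : H' 0 j 0%MM = 0.
  by rewrite H'E fcoefD fcoefM0 coefHM row0 mul0mx mxE lam0 mul0r addr0.
have H'U i j : H' 0 j U_(i)%MM = ((\row_m H 0 m U_(i)%MM) *m A) 0 j.
  rewrite H'E fcoefD coefHM [(lam * _) _](_ : _ = 0) ?addr0 //.
  by apply: (order_geM (order_ge1 lam0) (order_ge1 (H'0 j))); rewrite mdeg1.
have rowE m : \row_i H 0 i m = row_mx (\row_j H 0 (lshift 1 j) m) (G m)%:M.
  apply/rowP => j; rewrite mxE -(splitK j); case: (split j) => j' /=.
    by rewrite row_mxEl mxE.
  by rewrite row_mxEr [j']ord1 mxE eqxx mulr1n.
have mulA (x : 'rV[C]_(n + k)) y : row_mx x y%:M *m A = row_mx (x *m V + (y * t) *: a) (y * t)%:M.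
  by rewrite mul_row_block mulmx0 add0r -scalar_mxM mul_scalar_mx scalerA.
have ct : c * t = s.
  have c0 := emb_transversal; have s0 : s != 0.
    by apply/eqP => s0; move/eqP: s2; rewrite s0 mul0r eq_sym oner_eq0.
  by rewrite /t invfM mulrCA mulfV // mulr1 -[LHS]mul1r -s2 mulfK.
have FwV : Fw *m V + s *: a = 0.
  by rewrite /a scaleNr scalerN scalerA s2 scale1r subrr.
have Ez i : (\row_m H 0 m U_(z i)%MM) *m A = row_mx (\row_j (j == lshift k (rho i))%:R) 0.
  rewrite rowE mulA Gz mul0r scale0r addr0; congr row_mx; last by rewrite raddf0.
  have -> : \row_j H 0 (lshift 1 j) U_(z i)%MM = row (rho i) P by rewrite rowK rhoK.
  rewrite -(WP (rho i) (lshift k (rho i)) erefl) -row_mul mulmxV //.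
  by apply/rowP => j; rewrite !mxE eq_sym.
have Ew : (\row_m H 0 m U_(w)%MM) *m A = row_mx 0 s%:M.
  by rewrite rowE mulA -/c ct FwV.
have [] // := @rigid_target R l n k s rho (ltnW ln) _ s2 sR rhoK rhoS trace0 H' g' Hg'.
- by rewrite (leq_ltn_trans _ ln).
- by move=> j i; rewrite H'U Ez row_mxEl mxE (inj_eq (@lshift_inj _ _)).
- by move=> j i; rewrite H'U Ez row_mxEl mxE eq_rlshift.
- by move=> j; rewrite H'U Ew row_mxEl mxE.
- by rewrite H'U Ew row_mxEr mxE.
- pose q := sform l a (map_mx Num.conj a).
  have qR : q^* = q by exact: herm_conj.
  have rq : (r - 'i * q)^* = r + 'i * q.
    by rewrite rmorphB rmorphM /= rR qR conjCi mulNr opprK.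
  have lamw : lam U_(w)%MM = s * (r - 'i * q).
    rewrite /lam coefHM rowE mul_row_col mxE -/Fw -/c -scalemxAr mxE !mulmxA -sform_mx.
    have -> : Fw *m V = - s *: a by move/eqP: FwV; rewrite addr_eq0 scaleNr => /eqP.
    by rewrite sformZl -scalar_mxM mxE mulr1n mulrA ct -/q; ring.
  rewrite H'E fcoefD coefHM rowE mulA row_mxEr mxE mulr1n.
  rewrite (fcoefM_UU _ lam0 (H'0 _)) H'U Ew row_mxEr mxE mulr1n lamw.
  have -> : s * (r - 'i * q) * s = r - 'i * q by rewrite mulrAC s2 mul1r.
  rewrite [_ * t]mulrC; move: r2; set X := t * _ => r2.
  rewrite [(X + _)^*]rmorphD /= rq.
  have -> : X + (r - 'i * q) + (X^* + (r + 'i * q)) = (X + X^*) + r * 2 by ring.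
  by rewrite r2 subrr.
Qed.

End NormalForm.

(** * The two normal forms *)

Lemma target_row_ext (R : realType) (n k : nat) (M M' : 'rV[fps (n + 1) R[i]]_(n + k + 1)) :
  (forall j, M 0 (lshift 1 (lshift k j)) = M' 0 (lshift 1 (lshift k j))) ->
  (forall j, M 0 (lshift 1 (rshift n j)) = M' 0 (lshift 1 (rshift n j))) ->
  M 0 (rshift (n + k) ord0) = M' 0 (rshift (n + k) ord0) -> M = M'.
Proof.
move=> E1 E2 E3; apply/rowP => j; rewrite -(splitK j); case: (split j) => j' /=.
  by rewrite -(splitK j'); case: (split j') => j'' /=.
by rewrite [j']ord1.
Qed.

(** The sign of [c] selects the identity or the half turn of the coordinates. *)
Lemma half_signature_normal_form (R : realType) (l k : nat)
    (H : 'rV[fps (l + l + 1) R[i]]_(l + l + k + 1)) :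
  (0 < l)%N ->
  formal_embedding (hq_rho R l (l + l)) (hq_rho R l (l + l + k)) H ->
  exists T : 'rV[fps (l + l + k + 1) R[i]]_(l + l + k + 1),
    hq_aut R l (l + l + k) T /\
    (fcompv T H = emb_lin R (l + l) k \/ fcompv T H = emb_minus R l (l + l) k).
Proof.
move=> l0 He; have ln : (l < l + l)%N by lia.
have [_ cR _] := first_jet He.
have cn0 := emb_transversal ln He.
set c := (H 0 _ _) in cR cn0.
have cre : c \is Num.real by apply/CrealP.
have tr0 := sum_signl l R[i].
have [cpos|cneg|c0] := real_ltgtP (rpred0 _) cre; last 1 first.
- by rewrite c0 eqxx in cn0.
- have [T [aT T1 T2 T3]] := @normal_form R l (l + l) k ln H He 1 id (mulr1 _) (rmorph1 _)
    (fun _ => erefl) (fun t => esym (mul1r _)) tr0 ltac:(by rewrite mul1r).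
  exists T; split=> //; left; apply: target_row_ext => [j|j|].
  + by rewrite T1 !row_mxEl mxE.
  + by rewrite T2 row_mxEl row_mxEr mxE.
  + by rewrite T3 row_mxEr mxE rmorph1 mul1r.
have [T [aT T1 T2 T3]] := @normal_form R l (l + l) k ln H He (-1) (@half_turn l)
  ltac:(by rewrite mulrNN mulr1) (rmorphN1 _) (@half_turnK l)
  (fun t => etrans (signl_half_turn _ t) (esym (mulN1r _))) tr0
  ltac:(by rewrite mulN1r oppr_gt0).
exists T; split=> //; right; apply: target_row_ext => [j|j|].
+ by rewrite T1 !row_mxEl mxE nth_rot_half mxE.
+ by rewrite T2 row_mxEl row_mxEr mxE.
+ by rewrite T3 row_mxEr !mxE rmorphN1 mulN1r.
Qed.

Theorem theorem1p7 (R : realType) (n k : nat)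
    (H : 'rV[fps (n + 1) R[i]]_(n + k + 1)) :
  (0 < n)%N -> ~~ odd n ->
  formal_embedding (hq_rho R (n./2) n) (hq_rho R (n./2) (n + k)) H ->
  (k < n)%N ->
  exists T : 'rV[fps (n + k + 1) R[i]]_(n + k + 1),
    hq_aut R (n./2) (n + k) T /\
    (fcompv T H = emb_lin R n k \/ fcompv T H = emb_minus R (n./2) n k).
Proof.
move=> n0 n_even He _; have := odd_double_half n; rewrite (negPf n_even) add0n -addnn.
move: (n./2) He => l He E; case: n / E H He n0 {n_even} => H He l0.
by apply: half_signature_normal_form He; lia.
Qed.
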